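(* Suppose that every agent $i$ measures its body velocities $(\mathbf v_i^i,\boldsymbol\omega_i^i)$ and the relative transformations $\mathbf T_{ij}$, $j\in\mathcal N_i$, and that the interaction graph $\mathcal G$ contains a spanning tree. Let the auxiliary matrices $\mathbf P_i(t)=\begin{bmatrix}\mathbf Q_i(t)&\mathbf q_i(t)\\ \mathbf 0&1\end{bmatrix}$, $i=1,\dots,n$, evolve under the frame localization law $$\dot{\mathbf P}_i(t)=-\begin{bmatrix}\mathbf v_i^i\\ \boldsymbol\omega_i^i\end{bmatrix}^{\wedge}\mathbf P_i(t)+\sum_{j\in\mathcal N_i}\big(\mathbf T_{ij}(t)\mathbf P_j(t)-\mathbf P_i(t)\big),\qquad i=1,\dots,n,$$ and let $\hat{\mathbf R}_i^\top(t)=\mathrm{GSOP}(\mathbf Q_i(t))$, $\hat{\mathbf p}_i(t):=-\hat{\mathbf R}_i(t)\mathbf q_i(t)$, $\hat{\mathbf T}_i(t):=\begin{bmatrix}\hat{\mathbf R}_i(t)&\hat{\mathbf p}_i(t)\\ \mathbf 0&1\end{bmatrix}$. Let $$\mathbf Q_c:=\sum_{i=1}^n w_{1i}\mathbf R_i(0)\mathbf Q_i(0),\qquad \mathbf q_c:=\sum_{i=1}^n w_{1i}\big(\mathbf R_i(0)\mathbf q_i(0)+\mathbf p_i(0)\big),\qquad \mathbf R_c:=\mathrm{GSOP}(\mathbf Q_c).$$ The space $\mathrm{null}(\mathbf w_1\otimes\mathbf I_3)$ has dimension $3(n-1)$, so it is a lower-dimensional subspace of $\mathbb R^{3n}$ and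 has Lebesgue measure zero. Thus the steady-state estimates of the frame transformations $\hat{\mathbf T}_i$, $i\in\mathcal V$, are well-defined (i.e. $\mathbf Q_c$ is nonsingular) for almost all initial matrices $\{\mathbf P_i(0)\}_{i\in\mathcal V}$. Further, the frame transformations of the agents are computed almost globally exponentially up to the common constant transformation $\mathbf T_c=\begin{bmatrix}\mathbf R_c&\mathbf q_c\\ \mathbf 0&1\end{bmatrix}\in SE(3)$; that is, for almost all initial matrices $\{\mathbf P_i(0)\}_{i\in\mathcal V}$, $$\hat{\mathbf T}_i(t)\to\mathbf T_c^{-1}\mathbf T_i(t)\quad\text{exponentially as }t\to\infty,\ \text{for all } i\in\mathcal V,$$ i.e. $\hat{\mathbf R}_i\to\mathbf R_c^\top\mathbf R_i$ and $\hat{\mathbf p}_i\to\mathbf R_c^\top(\mathbf p_i-\mathbf q_c)$. In other words, the frame transformations of the agents are computed relative to a reference frame whose frame transformation is $\mathbf T_c$.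
   Context: There are $n$ agents in $\mathbb R^3$. Agent $i$ has a time-varying pose $\mathbf T_i(t)=\begin{bmatrix}\mathbf R_i(t)&\mathbf p_i(t)\\ \mathbf 0&1\end{bmatrix}\in SE(3)$, with $\mathbf R_i\in SO(3)$, $\mathbf p_i\in\mathbb R^3$, satisfying $\dot{\mathbf T}_i=\mathbf T_i\begin{bmatrix}\mathbf v_i^i\\ \boldsymbol\omega_i^i\end{bmatrix}^{\wedge}$, where $\mathbf v_i^i,\boldsymbol\omega_i^i\in\mathbb R^3$ are the linear and angular velocities of agent $i$ in its body frame. Here $\begin{bmatrix}\mathbf v\\ \boldsymbol\omega\end{bmatrix}^{\wedge}=\begin{bmatrix}\boldsymbol\omega^\wedge&\mathbf v\\ \mathbf 0&0\end{bmatrix}\in\mathbb R^{4\times4}$ and $\boldsymbol\omega^\wedge\in\mathbb R^{3\times3}$ is the skew-symmetric matrix with $\boldsymbol\omega^\wedge\mathbf x=\boldsymbol\omega\times\mathbf x$. The relative transformation is $\mathbf T_{ij}=\mathbf T_i^{-1}\mathbf T_j$. All measurements are noise-free. The interaction graph is $\mathcal G=(\mathcal V,\mathcal E)$, $\mathcal V=\{1,\dots,n\}$, possibly directed; $(i,j)\in\mathcal E$ means agent $i$ measures $\mathbf T_{ij}$ and receives information from $j$; $\mathcal N_i=\{j:(i,j)\in\mathcal E\}$. The Laplacian $\mathbf L=[l_{ij}]$ has $l_{ij}=-1$ if $(i,j)\in\mathcal E$, $i\ne j$, $l_{ii}=-\sum_{j\in\mathcal N_i}l_{ij}$, and $l_{ij}=0$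 otherwise. ''$\mathcal G$ contains a spanning tree'' means there is a root vertex $r$ from which information can reach every agent, i.e. for every $i\in\mathcal V$ there is a directed path $i=i_0,i_1,\dots,i_k=r$ with $(i_l,i_{l+1})\in\mathcal E$. The row vector $\mathbf w_1=[w_{11},\dots,w_{1n}]$ is the left eigenvector of $\mathbf L$ for the zero eigenvalue, normalized by $\mathbf w_1\mathbf 1_n=1$, where $\mathbf 1_n$ is the all-ones vector; $\otimes$ is the Kronecker product and $\mathbf I_3$ the $3\times3$ identity. Each $\mathbf P_i\in\mathbb R^{4\times4}$ has the displayed block form with $\mathbf Q_i\in\mathbb R^{3\times3}$, $\mathbf q_i\in\mathbb R^3$; ''almost all initial matrices'' refers to Lebesgue measure on the entries of $(\mathbf Q_i(0),\mathbf q_i(0))_{i\in\mathcal V}$. GSOP: for a matrix with columns $\mathbf z_1,\mathbf z_2,\mathbf z_3\in\mathbb R^3$, set $\mathbf u_k=\mathbf z_k-\sum_{l<k}\langle\mathbf z_k,\mathbf y_l\rangle\mathbf y_l$, $\mathbf y_k=\mathbf u_k/\|\mathbf u_k\|$ for $k=1,2$, and $\mathbf y_3=\beta\,\mathbf u_3/\|\mathbf u_3\|$ with $\beta=\mathrm{sign}\det[\mathbf y_1,\mathbf y_2,\mathbf u_3/\|\mathbf u_3\|]$; if some $\mathbf u_k=\mathbf 0$, put $\mathbf y_k=\mathbf 0$. The output is $[\mathbf y_1,\mathbf y_2,\mathbf y_3]$, which lies in $SO(3)$ when the input is nonsingular.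
   Formalization: Convergence of the full estimate T̂_i and of p̂_i is proved only when that agent's position p_i(t) grows subexponentially; without a growth bound it fails (e.g. p_1 = e^{2t}x). Convergence of R̂_i and of T̂_i T_i^{-1} to T_c^{-1} needs no such bound. *)

(* Defs.v *)
(* MathComp / MathComp-Analysis *)
From HB Require Import structures.
From mathcomp Require Import all_boot all_order all_algebra.
From mathcomp Require Import mxtens.
From mathcomp Require Import all_classical all_reals all_analysis.

Set Implicit Arguments.
Unset Strict Implicit.
Unset Printing Implicit Defensive.

Import Order.TTheory GRing.Theory Num.Theory.
Import numFieldNormedType.Exports.

Local Open Scope classical_set_scope.
Local Open Scope ring_scope.

Section Geometry.
Variable R : realType.

Definition SO3 (A : 'M[R]_3) : Prop := A^T *m A = 1%:M /\ \det A = 1.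

(* Also used for the auxiliary matrices P_i, whose upper-left block is an
   arbitrary 3 x 3 matrix. *)
Definition pose (A : 'M[R]_3) (b : 'cV[R]_3) : 'M[R]_(3 + 1) :=
  block_mx A b 0 1%:M.

Definition cross_mx (w : 'cV[R]_3) : 'M[R]_3 :=
  \matrix_(i, j)
    nth 0 (nth [::] [:: [:: 0; - w 2 0; w 1 0];
                        [:: w 2 0; 0; - w 0 0];
                        [:: - w 1 0; w 0 0; 0] ] i) j.

Definition twist (v w : 'cV[R]_3) : 'M[R]_(3 + 1) := block_mx (cross_mx w) v 0 0.

Definition dot (x y : 'cV[R]_3) : R := (x^T *m y) 0 0.

(* Euclidean norm: the library norm `|_| on matrices is the max norm. *)
Definition enorm (x : 'cV[R]_3) : R := Num.sqrt (dot x x).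

(* Since 0^-1 = 0, [normalize 0 = 0], the convention for vanishing vectors in
   the Gram-Schmidt procedure. *)
Definition normalize (x : 'cV[R]_3) : 'cV[R]_3 := (enorm x)^-1 *: x.

Definition mx_of_cols (x y z : 'cV[R]_3) : 'M[R]_3 :=
  \matrix_(i, j) (nth 0 [:: x; y; z] j) i 0.

Definition GSOP (Z : 'M[R]_3) : 'M[R]_3 :=
  let z1 := col 0 Z in let z2 := col 1 Z in let z3 := col 2 Z in
  let y1 := normalize z1 in
  let y2 := normalize (z2 - dot z2 y1 *: y1) in
  let u3 := z3 - dot z3 y1 *: y1 - dot z3 y2 *: y2 in
  let beta := Num.sg (\det (mx_of_cols y1 y2 (normalize u3))) in
  mx_of_cols y1 y2 (beta *: normalize u3).

End Geometry.

Section Graph.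
Variables (n : nat) (e : rel 'I_n).

(* [e i j] means that agent i measures, and receives information from, j. *)
Definition has_spanning_tree : Prop := exists r, forall i, connect e i r.

(* Self-loops, if any, are ignored; they also contribute
   T_ii P_i - P_i = 0 to [localization_rhs] below. *)
Definition laplacian (R : realType) : 'M[R]_n :=
  \matrix_(i, j) if i == j then \sum_(k | e i k && (k != i)) 1
                 else - (e i j)%:R.

End Graph.

Section Analysis.
Variable R : realType.

(* x is a solution of x' = F on [0, +oo[.  Only continuity is asked at the
   initial time, which covers the case of a right derivative at 0. *)
Definition solves m k (x F : R -> 'M[R]_(m, k)) : Prop :=
  {within `[0, +oo[, continuous x} /\
  forall t : R, 0 < t -> is_derive t 1 x (F t).

Definition exp_cvg m k (f g : R -> 'M[R]_(m, k)) : Prop :=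
  exists c lambda : R, 0 < lambda /\
    forall t, 0 <= t -> `|f t - g t| <= c * expR (- (lambda * t)).

(* Needed for positions: the rotation estimates converge at a finite
   exponential rate, and their error is multiplied by the position, so a
   position growing faster would make the position estimate diverge. *)
Definition subexponential m k (f : R -> 'M[R]_(m, k)) : Prop :=
  forall eps : R, 0 < eps ->
    exists c : R, forall t, 0 <= t -> `|f t| <= c * expR (eps * t).

(* Lebesgue outer measure on R^I: the library has no Lebesgue measure on
   finite powers of R.  The sets of outer measure 0 are the Lebesgue-null
   sets. *)
Definition lebesgue_outer (I : finType) (A : set (I -> R)) : \bar R :=
  ereal_inf [set s | exists a b : nat -> I -> R,
    [/\ forall k i, a k i <= b k i,
        A `<=` \bigcup_k [set x | forall i, a k i <= x i <= b k i]
      & s = (\sum_(0 <= k <oo) (\prod_i (b k i - a k i))%:E)%E] ].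

Definition lebesgue_null (I : finType) (A : set (I -> R)) : Prop :=
  lebesgue_outer A = 0%E.

Definition almost_all (I : finType) (P : (I -> R) -> Prop) : Prop :=
  lebesgue_null [set x | ~ P x].

End Analysis.

Section Localization.
Variables (R : realType) (n : nat).

(* The coordinates of the initial data: (i, inl (a, b)) indexes the entry
   (a, b) of Q_i(0) and (i, inr a) the entry a of q_i(0). *)
Definition init_index : finType := ('I_n * ('I_3 * 'I_3 + 'I_3))%type.

Definition init_Q (x : init_index -> R) (i : 'I_n) : 'M[R]_3 :=
  \matrix_(a, b) x (i, inl (a, b)).

Definition init_q (x : init_index -> R) (i : 'I_n) : 'cV[R]_3 :=
  \col_a x (i, inr a).

Definition localization_rhs (e : rel 'I_n) (v omega : 'I_n -> R -> 'cV[R]_3)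
    (T P : 'I_n -> R -> 'M[R]_(3 + 1)) (i : 'I_n) (t : R) : 'M[R]_(3 + 1) :=
  - (twist (v i t) (omega i t) *m P i t) +
  \sum_(j | e i j) (invmx (T i t) *m T j t *m P j t - P i t).

Definition consensus_Q (w : 'rV[R]_n) (Rot0 Q0 : 'I_n -> 'M[R]_3) : 'M[R]_3 :=
  \sum_i w 0 i *: (Rot0 i *m Q0 i).

Definition consensus_q (w : 'rV[R]_n) (Rot0 : 'I_n -> 'M[R]_3)
    (p0 q0 : 'I_n -> 'cV[R]_3) : 'cV[R]_3 :=
  \sum_i w 0 i *: (Rot0 i *m q0 i + p0 i).

Definition Rhat (Q : 'M[R]_3) : 'M[R]_3 := (GSOP Q)^T.

Definition phat (Q : 'M[R]_3) (q : 'cV[R]_3) : 'cV[R]_3 := - (Rhat Q *m q).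

Definition That (Q : 'M[R]_3) (q : 'cV[R]_3) : 'M[R]_(3 + 1) :=
  pose (Rhat Q) (phat Q q).

End Localization.

(* Main.v *)
Require Import Defs.
From HB Require Import structures.
From mathcomp Require Import all_boot all_order all_algebra.
From mathcomp Require Import mxtens.
From mathcomp Require Import all_classical all_reals all_analysis.
From mathcomp Require Import ring lra.

Set Implicit Arguments.
Unset Strict Implicit.
Unset Printing Implicit Defensive.

Import Order.TTheory GRing.Theory Num.Theory.
Import numFieldNormedType.Exports.

Local Open Scope classical_set_scope.
Local Open Scope ring_scope.

(** In the world frame the localization law is plain consensus.  Put
    X_i = T_i P_i.  Since T_i' = T_i twist_i, the term - twist_i P_i of the law
    cancels and X_i' = sum_(j in N_i) (X_j - X_i), entry by entry
    ([world_frame_consensus]).  So each entry converges exponentially to the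
    w-weighted average of its initial values ([consensus_exponential]): the
    weighted sum is constant because w L = 0, and the spread between the agents
    decays.  The limit of X_i is thus pose Q_c q_c, that is, R_i Q_i tends to Q_c
    and R_i q_i + p_i tends to q_c.

    The spread decays because consensus preserves order ([consensus_ge0]): bounds
    that hold at one time hold ever after.  At that time the root lies in the
    upper or in the lower half of the range, and during one unit of time its
    influence travels along the paths of the graph ([consensus_propagate]) and
    pulls every agent away from the opposite end of the range by a fixed fraction
    of the spread ([consensus_contract]).

    Gram-Schmidt commutes with rotations ([GSOP_rot]), so the estimate of R_i is
    (GSOP (R_i Q_i))^T R_i, where the argument of GSOP now converges.  When Q_c is
    nonsingular, GSOP satisfies a Lipschitz bound at Q_c ([GSOP_lipschitz_at]),
    which carries the exponential rate over to the rotations.  The product of the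
    estimate of T_i and of T_i^-1 depends only on GSOP (R_i Q_i) and on
    R_i q_i + p_i; it therefore converges to T_c^-1, and multiplying it by T_i
    costs part of the rate when p_i grows subexponentially.

    The exceptional initial data are those with det Q_c = 0.  A locally Lipschitz
    image of R^d that ignores one coordinate is null, by counting boxes
    ([thin_image]).  A hyperplane is such an image, and so is the set of data with
    det Q_c = 0: a singular 3 x 3 matrix has a column that is a combination of the
    two others, which leaves 8 parameters instead of 9
    ([singular_consensus_thin]). *)

(** * Consensus on a rooted graph *)

Section Consensus.
Variables (R : realType) (n : nat) (e : rel 'I_n).

Definition consensus_sol (x : 'I_n -> R -> R) : Prop :=
  (forall i, {within `[0, +oo[, continuous (x i)}) /\
  (forall (i : 'I_n) (t : R), 0 < t ->
     is_derive t 1 (x i) (\sum_(j | e i j) (x j t - x i t))).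

Lemma left_lt_of_derive_gt0 (f : R -> R) (a s d : R) :
  is_derive s 1 f d -> 0 < d -> a < s -> exists2 r, a < r < s & f r < f s.
Proof.
move=> [fs <-] d0 as_.
have : \forall h \near 0^', 0 < h^-1 *: (f (h *: 1 + s) - f s).
  by move: d0; apply: cvgr_gt; exact: fs.
move=> /nbhs_ballP[r /= r0 H].
pose h := - (Num.min (r / 2) ((s - a) / 2)).
have m0 : 0 < Num.min (r / 2) ((s - a) / 2) by rewrite lt_min; apply/andP; split; lra.
have m1 : Num.min (r / 2) ((s - a) / 2) <= r / 2 by rewrite ge_min lexx.
have m2 : Num.min (r / 2) ((s - a) / 2) <= (s - a) / 2.
  by rewrite ge_min lexx orbT.
have hb : ball (0 : R) r h.
  by rewrite /ball /= sub0r opprK gtr0_norm //; lra.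
have h0 : h != 0 by rewrite oppr_eq0 gt_eqF.
have := H h hb h0; rewrite scaler1 => Hd.
exists (h + s); first by rewrite /h; apply/andP; split; lra.
move: Hd; rewrite -[h^-1 *: _]/(h^-1 * _) nmulr_rgt0 ?subr_lt0 //.
by rewrite invr_lt0 oppr_lt0.
Qed.

Lemma sol_continuous_itv x i (a b : R) :
  consensus_sol x -> 0 <= a -> {within `[a, b], continuous (x i)}.
Proof.
move=> [cx _] a0; apply: continuous_subspaceW (cx i) => t /=.
rewrite !in_itv /= andbT => /andP[at_ _]; exact: le_trans at_.
Qed.

Lemma consensus_affine x (a b : R) :
  consensus_sol x -> consensus_sol (fun i t => a * x i t + b).
Proof.
move=> [cx dx]; split=> [i|i t t0].
  move=> t; apply: cvgD; last exact: cvg_cst.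
  by apply: cvgM; [exact: cvg_cst|exact: cx].
have := dx i t t0 => dxi.
have H : is_derive t 1 (cst a * x i + cst b)
    (a *: (\sum_(j | e i j) (x j t - x i t)) + x i t *: 0 + 0) by exact: is_deriveD.
apply: is_derive_eq H _.
rewrite scaler0 !addr0 -[_ *: _]/(_ * _) mulr_sumr; apply: eq_bigr => j _.
by ring.
Qed.

(** At a negative minimum over agents and times, the neighbours only push the
    agent up, so its value was smaller just before. *)
Lemma consensus_ge0 x (t0 t : R) i : consensus_sol x -> 0 <= t0 ->
  (forall j, 0 <= x j t0) -> t0 <= t -> 0 <= x i t.
Proof.
move=> sx t00 x0 t0t; rewrite leNgt; apply/negP => xit.
(* The damping factor makes the derivative at a negative minimum strictly
   positive, even when the neighbours exert no push. *)
pose u j s := expR (- s) * x j s.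
have cu j : {within `[t0, t], continuous (u j)}.
  move=> s; apply: cvgM; last exact: (sol_continuous_itv sx).
  apply: continuous_subspaceT => r.
  by apply: continuous_comp; [exact: opp_continuous|exact: continuous_expR].
have /choice[c cP] : forall j, exists c, c \in `[t0, t] /\
    forall s, s \in `[t0, t] -> u j c <= u j s.
  by move=> j; have [s] := EVT_min t0t (cu j); exists s.
have [k _ kmin] := @arg_minP _ _ _ i xpredT (fun j => u j (c j)) isT.
have [/itvP ck ckmin] := cP k.
have kall j s : s \in `[t0, t] -> u k (c k) <= u j s.
  by move=> st; apply: le_trans (kmin j isT) _; exact: (cP j).2.
have uk0 : u k (c k) < 0.
  apply: le_lt_trans (kall i t _) _; first by rewrite in_itv /= t0t lexx.
  by rewrite pmulr_rlt0 // expR_gt0.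
have ckt0 : t0 < c k.
  rewrite lt_neqAle ck andbT; apply/eqP => ckE.
  by move: uk0; rewrite -ckE pmulr_rlt0 ?expR_gt0 // ltNge x0.
have ck0 : 0 < c k by apply: le_lt_trans ckt0.
have dk := sx.2 k _ ck0.
have dex : is_derive (c k) 1 (fun s : R => expR (- s)) (- expR (- c k)).
  have H : is_derive (c k) 1 (expR \o -%R) (expR (- c k) * -1).
    by apply: (@is_derive1_comp _ expR -%R); exact: is_deriveNid.
  by apply: is_derive_eq H _; rewrite mulrN1.
have du : is_derive (c k) 1 (u k) (expR (- c k) *: (\sum_(j | e k j)
    (x j (c k) - x k (c k))) + x k (c k) *: (- expR (- c k))).
  exact: is_deriveM.
have d0 : 0 < expR (- c k) *: (\sum_(j | e k j) (x j (c k) - x k (c k))) +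
    x k (c k) *: (- expR (- c k)).
  apply: ltr_wpDl.
    apply: mulr_ge0; first exact: expR_ge0.
    apply: sumr_ge0 => j _; rewrite subr_ge0.
    have := kall j (c k); rewrite in_itv /= !ck => /(_ isT).
    by rewrite /u ler_pM2l // expR_gt0.
  by move: uk0; rewrite /u -[_ *: _]/(_ * _) mulrN oppr_gt0 mulrC.
have [s /andP[s1 s2]] := left_lt_of_derive_gt0 du d0 ckt0.
rewrite ltNge ckmin // in_itv /= (ltW s1) /=.
by apply: le_trans (ltW s2) _; rewrite ck.
Qed.

(** Rescaled by exp(n t), agent i obeys z_i' >= sum_(j in N_i) z_j, because the
    loss term has at most n summands; any slower g stays below it. *)
Lemma consensus_supersolution x (t0 : R) i (g dg : R -> R) (t : R) :
  consensus_sol x -> 0 <= t0 -> (forall j, 0 <= x j t0) -> t0 <= t ->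
  (forall s, t0 <= s -> is_derive s 1 g (dg s)) -> g t0 <= x i t0 ->
  (forall s, t0 <= s ->
     dg s <= expR (n%:R * (s - t0)) * \sum_(j | e i j) x j s) ->
  g t <= expR (n%:R * (t - t0)) * x i t.
Proof.
move=> sx t00 x0 t0t g' gt0 gle.
pose E s := expR (n%:R * (s - t0)).
have dE (s : R) : is_derive s 1 E (n%:R * E s).
  have H : is_derive s 1 (expR \o (fun s => n%:R * (s - t0)))
     (E s * (n%:R *: (1 - 0) + (s - t0) *: 0)).
    apply: is_derive1_comp.
    by apply: (@is_deriveM _ _ (cst n%:R) (id - cst t0)).
  by apply: is_derive_eq H _; rewrite subr0 scaler0 addr0 [_%:R *: 1]mulr1 mulrC.
pose f s := E s * x i s - g s.
have df (s : R) : s \in `]t0, t[ -> is_derive s 1 f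
   ((E s *: (\sum_(j | e i j) (x j s - x i s)) + x i s *: (n%:R * E s)) - dg s).
  rewrite in_itv /= => /andP[ts st].
  have s0 : 0 < s by apply: le_lt_trans ts.
  have := sx.2 i s s0 => dxi.
  have dgs := g' s (ltW ts).
  have ds := dE s.
  by apply: is_deriveB.
have cf : {within `[t0, t], continuous f}.
  move=> s; apply: cvgB.
    apply: cvgM; last exact: (sol_continuous_itv sx).
    apply: continuous_subspaceT => r.
    apply/differentiable_continuous/derivable1_diffP.
    by have [] := dE r.
  apply: continuous_in_subspaceT => r /=; rewrite inE /= in_itv /= => /andP[tr _].
  apply/differentiable_continuous/derivable1_diffP.
  by have [] := g' r tr.
have [c cin] := MVT_segment t0t df cf.
move: cin; rewrite in_itv /= => /andP[tc ct] fE.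
have f0 : 0 <= f t0 by rewrite /f /E subrr mulr0 expR0 mul1r subr_ge0.
rewrite -subr_ge0 -/(E t) -/(f t) -(subrK (f t0) (f t)) addr_ge0 //.
rewrite fE mulr_ge0 ?subr_ge0 //.
apply: le_trans (gle c tc) _.
have -> (S : R) : E c *: S + x i c *: (n%:R * E c) = E c * (S + n%:R * x i c).
  by rewrite -[E c *: S]/(E c * S) -[_ *: _]/(x i c * _); ring.
rewrite ler_pM2l ?expR_gt0 // big_split /= sumrN sumr_const -addrA lerDl.
rewrite addrC subr_ge0 -[x i c *+ _]mulr_natl ler_wpM2r //.
  exact: (consensus_ge0 i sx t00 x0 tc).
by rewrite ler_nat -[X in (_ <= X)%N](card_ord n) max_card.
Qed.

(** One integration per edge: if the rescaled z_j is at least s^k / k! x_r, s being the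
    elapsed time, then an agent i that listens to j has z_i' >= s^k / k! x_r,
    hence z_i >= s^(k+1) / (k+1)! x_r. *)
Lemma consensus_propagate x (t0 : R) (r : 'I_n) (p : seq 'I_n) i (t : R) :
  consensus_sol x -> 0 <= t0 -> (forall j, 0 <= x j t0) -> t0 <= t ->
  path e i p -> last i p = r ->
  (t - t0) ^+ size p / (size p)`!%:R * x r t0 <= expR (n%:R * (t - t0)) * x i t.
Proof.
move=> sx t00 x0; elim: p i t => [|k p IH] i t t0t /=.
  move=> _ ir; rewrite expr0 fact0 divr1 mul1r -{}ir.
  apply: (consensus_supersolution (g := cst (x i t0)) (dg := cst 0) sx) => // s t0s.
  rewrite mulr_ge0 ?expR_ge0 ?sumr_ge0 // => j _.
  exact: (consensus_ge0 j sx t00 x0 t0s).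
move=> /andP[eik pathp] lastp.
pose c := x r t0 / (size p).+1`!%:R.
rewrite -mulrA [_^-1 * _]mulrC -/c.
apply: (consensus_supersolution (g := fun s => (s - t0) ^+ (size p).+1 * c)
  (dg := fun s => (s - t0) ^+ size p / (size p)`!%:R * x r t0) sx) => //.
- move=> s t0s.
  have dB : is_derive s 1 (id - cst t0 : R -> R) (1 - 0).
    exact: is_deriveB.
  have dX := @is_deriveX _ _ _ (size p).+1 _ _ _ dB.
  have dc : is_derive s 1 (cst c : R -> R) 0 by exact: is_derive_cst.
  have -> : (fun s => (s - t0) ^+ (size p).+1 * c) =
      ((id - cst t0) ^+ (size p).+1 * cst c : R -> R).
    by apply/funext => u; rewrite fctE exprfctE.
  apply: is_derive_eq (is_deriveM dX dc) _.
  rewrite scaler0 add0r subr0 /c factS natrM /= -[((id - cst t0) s)]/(s - t0).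
  rewrite scalerA [_%:A]mulr1.
  have f0 : (size p)`!%:R != 0 :> R by rewrite pnatr_eq0 -lt0n fact_gt0.
  by field; rewrite f0 gt_eqF // ltr_pwDl ?ler0n.
- by rewrite subrr expr0n mul0r; exact: x0.
- move=> s t0s; apply: le_trans (IH k s t0s pathp lastp) _.
  rewrite ler_pM2l ?expR_gt0 // (bigD1 k) //= lerDl sumr_ge0 // => j _.
  exact: (consensus_ge0 j sx t00 x0 t0s).
Qed.

(** The factor of [consensus_propagate] after one unit of time along a path of at
    most n edges, halved because the root is only known to be at least half the
    spread away from one end of the range. *)
Definition contraction_gap : R := expR (- n%:R) / n`!%:R / 2.

Lemma contraction_gap_itv : 0 < contraction_gap < 1.
Proof.
have f0 : 0 < n`!%:R :> R by rewrite ltr0n fact_gt0.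
rewrite /contraction_gap !divr_gt0 ?expR_gt0 //= ltr_pdivrMr // mul1r.
apply: (@le_lt_trans _ _ 1); last by lra.
rewrite ler_pdivrMr // mul1r.
apply: (@le_trans _ _ 1); last by rewrite ler1n fact_gt0.
by rewrite -expR0 ler_expR oppr_le0.
Qed.

(** A shortest path has at most n edges, which makes the constant uniform. *)
Lemma consensus_root_pull x (t0 : R) (r i : 'I_n) :
  consensus_sol x -> 0 <= t0 -> (forall j, 0 <= x j t0) -> connect e i r ->
  2 * contraction_gap * x r t0 <= x i (t0 + 1).
Proof.
move=> sx t00 x0 /connectP[p0 ep0 lastp0].
case/shortenP: ep0 lastp0 => p ep up _ lastp.
have tt : t0 <= t0 + 1 by rewrite lerDl.
have := consensus_propagate sx t00 x0 tt ep (esym lastp).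
rewrite addrC addKr expr1n mulr1 div1r => h.
have szp : (size p <= n)%N.
  by have := max_card (mem (i :: p)); rewrite card_ord (card_uniqP up) => /ltnW.
have -> : 2 * contraction_gap = expR (- n%:R) / n`!%:R.
  by rewrite /contraction_gap mulrC divfK.
rewrite -(ler_pM2l (expR_gt0 n%:R)); apply: le_trans h.
rewrite 2!mulrA expRN divff ?mul1r ?gt_eqF ?expR_gt0 //.
rewrite ler_wpM2r // lef_pV2 ?posrE ?ltr0n ?fact_gt0 //.
by rewrite ler_nat leq_fact.
Qed.

Lemma consensus_between x (m M t0 t : R) i : consensus_sol x -> 0 <= t0 ->
  (forall j, m <= x j t0 <= M) -> t0 <= t -> m <= x i t <= M.
Proof.
move=> sx t00 xb t0t.
have h1 := consensus_ge0 i (consensus_affine 1 (- m) sx) t00 _ t0t.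
have h2 := consensus_ge0 i (consensus_affine (- 1) M sx) t00 _ t0t.
apply/andP; split.
  have := h1 (fun j => _); rewrite mul1r subr_ge0; apply=> j.
  by rewrite mul1r subr_ge0; case/andP: (xb j).
have := h2 (fun j => _); rewrite mulN1r addrC subr_ge0; apply=> j.
by rewrite mulN1r addrC subr_ge0; case/andP: (xb j).
Qed.

Lemma consensus_contract x (m M t0 : R) : has_spanning_tree e ->
  consensus_sol x -> 0 <= t0 -> (forall j, m <= x j t0 <= M) ->
  exists m' M', (forall j, m' <= x j (t0 + 1) <= M') /\
     M' - m' = (1 - contraction_gap) * (M - m).
Proof.
move=> [r er] sx t00 xb.
have tt : t0 <= t0 + 1 by rewrite lerDl.
have nxt j := consensus_between j sx t00 xb tt.
have /andP[g0 _] := contraction_gap_itv.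
have [hr|/ltW hr] := leP ((m + M) / 2) (x r t0).
  exists (m + contraction_gap * (M - m)), M; split=> [j|]; last by ring.
  case/andP: (nxt j) => _ ->; rewrite andbT.
  have sy := consensus_affine 1 (- m) sx.
  have y0 k : 0 <= 1 * x k t0 - m by rewrite mul1r subr_ge0; case/andP: (xb k).
  have := consensus_root_pull sy t00 y0 (er j); nra.
exists m, (M - contraction_gap * (M - m)); split=> [j|]; last by ring.
case/andP: (nxt j) => -> _ /=.
have sy := consensus_affine (- 1) M sx.
have y0 k : 0 <= - 1 * x k t0 + M.
  by rewrite mulN1r addrC subr_ge0; case/andP: (xb k).
have := consensus_root_pull sy t00 y0 (er j); nra.
Qed.

Lemma consensus_steps x (m M : R) : has_spanning_tree e ->
  consensus_sol x -> (forall j, m <= x j 0 <= M) ->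
  forall k : nat, exists m' M', (forall j, m' <= x j k%:R <= M') /\
    M' - m' = (1 - contraction_gap) ^+ k * (M - m).
Proof.
move=> er sx xb; elim=> [|k [m' [M' [xb' E']]]].
  by exists m, M; rewrite expr0 mul1r.
have [m1 [M1 [xb1 E1]]] := consensus_contract er sx (ler0n R k) xb'.
exists m1, M1; rewrite -natr1; split=> //.
by rewrite E1 E' exprS mulrA.
Qed.

Definition consensus_rate : R := - ln (1 - contraction_gap).

Lemma consensus_rate_gt0 : 0 < consensus_rate.
Proof.
have /andP[g0 g1] := contraction_gap_itv.
by rewrite oppr_gt0 ln_lt0 // subr_gt0 g1 ltrBlDr ltrDl.
Qed.

Lemma consensus_spread x : has_spanning_tree e -> consensus_sol x ->
  exists c, forall i j (t : R), 0 <= t ->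
    `|x i t - x j t| <= c * expR (- (consensus_rate * t)).
Proof.
move=> er sx; have /andP[g0 g1] := contraction_gap_itv.
pose B := \sum_j `|x j 0|.
have xB j : - B <= x j 0 <= B.
  by rewrite -ler_norml /B (bigD1 j) //= lerDl sumr_ge0.
have B0 : 0 <= B by exact: sumr_ge0.
exists ((B - - B) * expR consensus_rate) => i j t t0.
have [m [M [xb E]]] := consensus_steps er sx xB (Num.truncn t).
have /andP[kt tk] := truncn_itv t0.
have /andP[mi Mi] := consensus_between i sx (ler0n _ _) xb kt.
have /andP[mj Mj] := consensus_between j sx (ler0n _ _) xb kt.
have gE : 1 - contraction_gap = expR (- consensus_rate).
  by rewrite opprK lnK // posrE subr_gt0.
apply: (@le_trans _ _ (M - m)); first by rewrite ler_distlC; lra.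
rewrite E gE -expRM_natl -mulrA -expRD mulrC.
rewrite ler_wpM2l ?ler_expR //; first by lra.
move: tk; rewrite -natr1 => tk.
have := consensus_rate_gt0; nra.
Qed.

Lemma laplacianE (y : 'I_n -> R) i :
  \sum_j laplacian e R i j * y j = \sum_(j | e i j) (y i - y j).
Proof.
rewrite (bigD1 i) //= mxE eqxx mulr_suml [RHS](bigID (pred1 i)) /=.
rewrite [X in _ = X + _]big1 ?add0r => [|j /andP[_ /eqP->]]; last exact: subrr.
rewrite [RHS]big_split /=; congr (_ + _); first by under eq_bigr do rewrite mul1r.
rewrite [RHS]big_mkcondl /=; apply: eq_bigr => j ji.
by rewrite mxE eq_sym (negbTE ji); case: (e i j); rewrite ?mulN1r ?oppr0 ?mul0r.
Qed.

Lemma is_derive_bigsum (I : Type) (s : seq I) (P : pred I)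
    (f : I -> R -> R) (df : I -> R) (t : R) :
  (forall i, P i -> is_derive t 1 (f i) (df i)) ->
  is_derive t 1 (fun u => \sum_(i <- s | P i) f i u) (\sum_(i <- s | P i) df i).
Proof.
move=> fP; elim: s => [|i s IH].
  by under [fun _ => _]funext do rewrite big_nil; rewrite big_nil; exact: is_derive_cst.
under [fun _ => _]funext do rewrite big_cons; rewrite big_cons.
by case: ifP => // Pi; apply: is_deriveD; exact: fP.
Qed.

Lemma consensus_average (w : 'rV[R]_n) x (t : R) : w *m laplacian e R = 0 ->
  consensus_sol x -> 0 <= t ->
  \sum_i w 0 i * x i t = \sum_i w 0 i * x i 0.
Proof.
move=> wL sx t0.
have df (s : R) : s \in `]0, t[ ->
    is_derive s 1 (fun u => \sum_i w 0 i * x i u) ((fun=> 0) s).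
  rewrite in_itv /= => /andP[s0 _].
  have H : is_derive s 1 (fun u => \sum_i w 0 i * x i u)
     (\sum_i w 0 i * (\sum_(j | e i j) (x j s - x i s))).
    apply: is_derive_bigsum => i _.
    have := sx.2 i s s0 => dxi.
    have dw : is_derive s 1 (cst (w 0 i) : R -> R) 0 by exact: is_derive_cst.
    by apply: is_derive_eq (is_deriveM dw dxi) _; rewrite scaler0 addr0.
  apply: is_derive_eq H _.
  transitivity (- \sum_j (w *m laplacian e R) 0 j * x j s).
    rewrite -sumrN; under [RHS]eq_bigr do rewrite mxE mulr_suml -sumrN.
    rewrite exchange_big /=; apply: eq_bigr => i _.
    under [RHS]eq_bigr do rewrite -mulrA; rewrite sumrN -mulr_sumr laplacianE.
    by rewrite -mulrN -sumrN; congr (_ * _); apply: eq_bigr => j _; rewrite opprB.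
  by rewrite wL big1 ?oppr0 // => j _; rewrite mxE mul0r.
have cf : {within `[0, t], continuous (fun u => \sum_i w 0 i * x i u)}.
  move=> s; apply: cvg_big => [|i _]; first exact: add_continuous.
  apply: cvgM; first exact: cvg_cst.
  exact: (sol_continuous_itv sx).
have [c _] := MVT_segment t0 df cf.
by rewrite mul0r => /subr0_eq.
Qed.

(** x_i minus the invariant average is the w-average of the differences
    x_i - x_j, so the decay of the spread suffices, whatever the signs of w. *)
Theorem consensus_exponential (w : 'rV[R]_n) x : has_spanning_tree e ->
  w *m laplacian e R = 0 -> \sum_i w 0 i = 1 -> consensus_sol x ->
  exists c, forall i (t : R), 0 <= t ->
    `|x i t - \sum_j w 0 j * x j 0| <= c * expR (- (consensus_rate * t)).
Proof.
move=> er wL w1 sx; have [c cP] := consensus_spread er sx.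
exists ((\sum_j `|w 0 j|) * c) => i t t0.
rewrite -(consensus_average wL sx t0) -[x i t]mul1r -w1 mulr_suml -sumrB.
apply: le_trans (ler_norm_sum _ _ _) _.
rewrite -mulrA mulr_suml; apply: ler_sum => j _.
by rewrite -mulrBr normrM ler_wpM2l // cP.
Qed.

End Consensus.

(** * Gram-Schmidt orthonormalization *)

Section ThreeDim.
Variable R : realType.
Implicit Types (x y z : 'cV[R]_3) (A Z : 'M[R]_3).

Lemma ord3P (P : 'I_3 -> Prop) : P 0 -> P 1 -> P 2 -> forall i, P i.
Proof.
move=> P0 P1 P2 [[|[|[|//]]] Hi].
- by rewrite (_ : Ordinal Hi = 0) //; exact: val_inj.
- by rewrite (_ : Ordinal Hi = 1) //; exact: val_inj.
- by rewrite (_ : Ordinal Hi = 2) //; exact: val_inj.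
Qed.

Lemma sum3 (F : 'I_3 -> R) : \sum_i F i = F 0 + F 1 + F 2.
Proof.
rewrite !big_ord_recl big_ord0 addr0 addrA.
by congr (_ + F _ + F _); exact: val_inj.
Qed.

Lemma det3 A : \det A =
  A 0 0 * (A 1 1 * A 2 2 - A 1 2 * A 2 1) -
  A 0 1 * (A 1 0 * A 2 2 - A 1 2 * A 2 0) +
  A 0 2 * (A 1 0 * A 2 1 - A 1 1 * A 2 0).
Proof.
have l0 : lift (0 : 'I_3) (0 : 'I_2) = 1 by exact: val_inj.
have l1 : lift (0 : 'I_3) (1 : 'I_2) = 2 by exact: val_inj.
have l2 : lift (1 : 'I_3) (0 : 'I_2) = 0 by exact: val_inj.
have l3 : lift (1 : 'I_3) (1 : 'I_2) = 2 by exact: val_inj.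
have l4 : lift (2 : 'I_3) (0 : 'I_2) = 0 by exact: val_inj.
have l5 : lift (2 : 'I_3) (1 : 'I_2) = 1 by exact: val_inj.
have d2 (B : 'M[R]_2) : \det B = B 0 0 * B 1 1 - B 0 1 * B 1 0.
  rewrite (expand_det_row _ 0) !big_ord_recl big_ord0 /cofactor !det_mx11 !mxE /=.
  have k0 : lift ord0 ord0 = 1 :> 'I_2 by exact: val_inj.
  have k1 : lift 0 0 = 1 :> 'I_2 by exact: val_inj.
  have k2 : lift 1 0 = 0 :> 'I_2 by exact: val_inj.
  by rewrite ?(k0, k1, k2) /= ?(addn0, add0n) expr0 expr1 addr0 mul1r mulN1r mulrN.
rewrite (expand_det_row _ 0) sum3 /cofactor !d2 !mxE !l0 !l1 !l2 !l3 !l4 !l5.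
by rewrite /= !(add0n, expr0, expr1, addn0) -signr_odd /= expr0; ring.
Qed.

Lemma dotE x y : dot x y = x 0 0 * y 0 0 + x 1 0 * y 1 0 + x 2 0 * y 2 0.
Proof. by rewrite /dot mxE sum3 !mxE. Qed.

Lemma dotC x y : dot x y = dot y x.
Proof. by rewrite !dotE; ring. Qed.

Lemma dotZl a x y : dot (a *: x) y = a * dot x y.
Proof. by rewrite !dotE !mxE; ring. Qed.

Lemma dotBl x y z : dot (x - y) z = dot x z - dot y z.
Proof. by rewrite !dotE !mxE; ring. Qed.

Lemma dot_ge0 x : 0 <= dot x x.
Proof. by rewrite dotE -!expr2 !addr_ge0 ?sqr_ge0. Qed.

Lemma entry_sqr_le_dot x i : x i 0 ^+ 2 <= dot x x.
Proof.
rewrite dotE -!expr2; move: (sqr_ge0 (x 0 0)) (sqr_ge0 (x 1 0)) (sqr_ge0 (x 2 0)).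
by elim/ord3P: i => a b c; lra.
Qed.

Lemma enorm_sqr x : enorm x ^+ 2 = dot x x.
Proof. by rewrite sqr_sqrtr ?dot_ge0. Qed.

Lemma enorm_eq0 x : enorm x = 0 -> x = 0.
Proof.
move=> x0; apply/matrixP => i j; rewrite ord1 mxE.
have := entry_sqr_le_dot x i; rewrite -enorm_sqr x0 expr0n /= => h.
by apply/eqP; rewrite -sqrf_eq0 eq_le h sqr_ge0.
Qed.

Lemma normalizeK x : enorm x *: normalize x = x.
Proof.
have [/enorm_eq0->|x0] := eqVneq (enorm x) 0; first by rewrite /normalize !scaler0.
by rewrite scalerA divff ?scale1r.
Qed.

Lemma dot_normalize x : enorm x != 0 -> dot (normalize x) (normalize x) = 1.
Proof.
by move=> x0; rewrite dotZl dotC dotZl -enorm_sqr; field.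
Qed.

Lemma normalize_entry_le1 x i : `|normalize x i 0| <= 1.
Proof.
have [/enorm_eq0->|x0] := eqVneq (enorm x) 0.
  by rewrite /normalize scaler0 mxE normr0.
rewrite -(@ler_pXn2r _ 2) ?nnegrE // expr1n -normrX ger0_norm ?sqr_ge0 //.
by rewrite -(dot_normalize x0) entry_sqr_le_dot.
Qed.

Lemma dot_rot A x y : A^T *m A = 1%:M -> dot (A *m x) (A *m y) = dot x y.
Proof. by move=> AA; rewrite /dot trmx_mul -mulmxA (mulmxA A^T) AA mul1mx. Qed.

Lemma normalize_rot A x : A^T *m A = 1%:M -> normalize (A *m x) = A *m normalize x.
Proof. by move=> AA; rewrite /normalize /enorm dot_rot // scalemxAr. Qed.

Lemma mx_of_colsM A x y z :
  mx_of_cols (A *m x) (A *m y) (A *m z) = A *m mx_of_cols x y z.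
Proof.
apply/matrixP => i j; rewrite !mxE.
by elim/ord3P: j => /=; rewrite mxE; apply: eq_bigr => k _; rewrite !mxE.
Qed.

Definition gs2_residual Z : 'cV[R]_3 :=
  col 1 Z - dot (col 1 Z) (normalize (col 0 Z)) *: normalize (col 0 Z).

Definition gs3_residual Z : 'cV[R]_3 :=
  col 2 Z - dot (col 2 Z) (normalize (col 0 Z)) *: normalize (col 0 Z)
    - dot (col 2 Z) (normalize (gs2_residual Z)) *: normalize (gs2_residual Z).

(** Kept apart from the sign correction, which is read off its determinant;
    [det_gs_frame] relates that determinant to the one of Z. *)
Definition gs_frame Z : 'M[R]_3 :=
  mx_of_cols (normalize (col 0 Z)) (normalize (gs2_residual Z))
             (normalize (gs3_residual Z)).

Lemma GSOPE Z : GSOP Z =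
  mx_of_cols (normalize (col 0 Z)) (normalize (gs2_residual Z))
             (Num.sg (\det (gs_frame Z)) *: normalize (gs3_residual Z)).
Proof. by []. Qed.

(** An isometry commutes with every step of the procedure, and a rotation keeps
    the determinant that fixes the sign of the last vector. *)
Lemma GSOP_rot A Z : SO3 A -> GSOP (A *m Z) = A *m GSOP Z.
Proof.
move=> [AA dA]; have colM j : col j (A *m Z) = A *m col j Z by rewrite !colE mulmxA.
have r2 : gs2_residual (A *m Z) = A *m gs2_residual Z.
  by rewrite /gs2_residual !colM normalize_rot // dot_rot // mulmxBr scalemxAr.
have r3 : gs3_residual (A *m Z) = A *m gs3_residual Z.
  by rewrite /gs3_residual r2 !colM !normalize_rot // !dot_rot // !mulmxBr !scalemxAr.
rewrite !GSOPE /gs_frame r2 r3 colM !normalize_rot // mx_of_colsM det_mulmx dA mul1r.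
by rewrite scalemxAr mx_of_colsM.
Qed.

Lemma GSOP_entry_le1 Z i j : `|GSOP Z i j| <= 1.
Proof.
rewrite GSOPE mxE; elim/ord3P: j => /=; [exact: normalize_entry_le1..|].
rewrite mxE normrM normr_sg mulr_ile1 ?normalize_entry_le1 //.
by case: (_ == 0); rewrite ?ler01.
Qed.

(** Each column of Z is the norm of its residual times its frame vector plus a
    combination of the previous frame vectors, so Z is the frame times a
    triangular matrix with the residual norms on the diagonal. *)
Lemma det_gs_frame Z : \det Z =
  enorm (col 0 Z) * enorm (gs2_residual Z) * enorm (gs3_residual Z) *
  \det (gs_frame Z).
Proof.
have colij j i : Z i j = col j Z i 0 by rewrite mxE.
have lin a b c x y z i :
    (a *: x + b *: y + c *: z) i 0 = a * x i 0 + b * y i 0 + c * z i 0 :> R.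
  by rewrite !mxE.
have E1 i : Z i 0 = enorm (col 0 Z) * normalize (col 0 Z) i 0.
  rewrite colij -{1}[col 0 Z]normalizeK.
  by have := lin (enorm (col 0 Z)) 0 0 (normalize (col 0 Z)) 0 0 i;
    rewrite !scaler0 !addr0 !mul0r !addr0.
have E2 i : Z i 1 = enorm (gs2_residual Z) * normalize (gs2_residual Z) i 0 +
    dot (col 1 Z) (normalize (col 0 Z)) * normalize (col 0 Z) i 0.
  rewrite colij.
  have {1}-> : col 1 Z = enorm (gs2_residual Z) *: normalize (gs2_residual Z) +
     dot (col 1 Z) (normalize (col 0 Z)) *: normalize (col 0 Z) + 0 *: 0.
    by rewrite normalizeK scaler0 addr0 subrK.
  by rewrite lin mul0r addr0.
have E3 i : Z i 2 = enorm (gs3_residual Z) * normalize (gs3_residual Z) i 0 +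
    dot (col 2 Z) (normalize (gs2_residual Z)) * normalize (gs2_residual Z) i 0 +
    dot (col 2 Z) (normalize (col 0 Z)) * normalize (col 0 Z) i 0.
  rewrite colij.
  have {1}-> : col 2 Z = enorm (gs3_residual Z) *: normalize (gs3_residual Z) +
     dot (col 2 Z) (normalize (gs2_residual Z)) *: normalize (gs2_residual Z) +
     dot (col 2 Z) (normalize (col 0 Z)) *: normalize (col 0 Z).
    by rewrite normalizeK !subrK.
  by rewrite lin.
rewrite !det3 ![gs_frame Z _ _]mxE /= !E1 !E2 !E3; ring.
Qed.

Lemma gs_residuals_neq0 Z : Z \in unitmx ->
  [/\ enorm (col 0 Z) != 0, enorm (gs2_residual Z) != 0,
      enorm (gs3_residual Z) != 0 & \det (gs_frame Z) != 0].
Proof.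
rewrite unitmxE unitfE (det_gs_frame Z) !mulf_eq0 !negb_or.
by rewrite -!andbA; case/and4P.
Qed.

Lemma mx_of_cols_orth x y z :
  dot x x = 1 -> dot y y = 1 -> dot z z = 1 ->
  dot y x = 0 -> dot z x = 0 -> dot z y = 0 ->
  (mx_of_cols x y z)^T *m mx_of_cols x y z = 1%:M.
Proof.
rewrite !dotE => xx yy zz yx zx zy; apply/matrixP => i j; rewrite mxE sum3 !mxE.
by elim/ord3P: i; elim/ord3P: j => /=; rewrite ?mulr1n ?mulr0n; lra.
Qed.

Lemma det_mx_of_colsZ x y z a :
  \det (mx_of_cols x y (a *: z)) = a * \det (mx_of_cols x y z).
Proof. by rewrite !det3 !mxE /=; ring. Qed.

Lemma GSOP_SO3 Z : Z \in unitmx -> SO3 (GSOP Z).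
Proof.
move=> /gs_residuals_neq0[n1 n2 n3 d0].
set y1 := normalize (col 0 Z); set y2 := normalize (gs2_residual Z).
set y3 := normalize (gs3_residual Z).
have [[d1 d2] d3] := (dot_normalize n1, dot_normalize n2, dot_normalize n3).
have d21 : dot y2 y1 = 0 by rewrite dotZl dotBl dotZl d1 mulr1 subrr mulr0.
have d12 : dot y1 y2 = 0 by rewrite dotC.
have d31 : dot y3 y1 = 0.
  by rewrite dotZl /gs3_residual -/y1 -/y2 !dotBl [dot (_ *: y1) _]dotZl
     [dot (_ *: y2) _]dotZl d1 d21 mulr1 subrr mulr0 subr0 mulr0.
have d32 : dot y3 y2 = 0.
  by rewrite dotZl /gs3_residual -/y1 -/y2 !dotBl [dot (_ *: y1) _]dotZl
     [dot (_ *: y2) _]dotZl d12 d2 mulr1 mulr0 subr0 subrr mulr0.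
pose b := Num.sg (\det (gs_frame Z)).
have bb : b * b = 1 by rewrite -expr2 sqr_sg d0.
split.
  rewrite GSOPE -/y1 -/y2 -/y3 -/b; apply: mx_of_cols_orth => //.
  - by rewrite [LHS]dotZl dotC [dot (b *: y3) _]dotZl d3 mulr1.
  - by rewrite [LHS]dotZl d31 mulr0.
  - by rewrite [LHS]dotZl d32 mulr0.
have -> : \det (GSOP Z) = b * \det (gs_frame Z).
  by rewrite GSOPE det_mx_of_colsZ.
rewrite /b -normrEsg.
have := mx_of_cols_orth d1 d2 d3 d21 d31 d32.
move=> /(congr1 determinant); rewrite det_mulmx det_tr det1 -expr2 => dd.
by apply/eqP; rewrite -(@eqrXn2 _ 2) // expr1n -normrX dd normr1.
Qed.

End ThreeDim.

(** * Calmness: a Lipschitz estimate at one point *)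

Section Calm.
Variables (R : realType) (V : normedModType R).
Implicit Types (f g : V -> R) (a : V).

(** Stable under the operations of the Gram-Schmidt procedure, and all that an
    exponential rate needs in order to survive the procedure. *)
Definition calm f a : Prop :=
  exists L, \forall z \near a, `|f z - f a| <= L * `|z - a|.

Lemma calm_cst (c : R) a : calm (fun=> c) a.
Proof.
by exists 0; near=> z; rewrite subrr normr0 mul0r.
Unshelve. all: by end_near. Qed.

Lemma eq_calm f g a : f =1 g -> calm g a -> calm f a.
Proof. by move=> /funext->. Qed.

Lemma calm_near f a eps : calm f a -> 0 < eps ->
  \forall z \near a, `|f z - f a| < eps.
Proof.
move=> [L fL] e0.
have L0 : 0 < `|L| + 1 by rewrite ltr_wpDl.
near=> z.
apply: (@le_lt_trans _ _ ((`|L| + 1) * `|z - a|)).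
  apply: le_trans (_ : _ <= L * `|z - a|) _; first by near: z.
  by rewrite ler_wpM2r // (le_trans (ler_norm L)) // lerDl.
rewrite mulrC -ltr_pdivlMr // distrC.
near: z; apply: cvgr_dist_lt; last exact: divr_gt0.
exact: cvg_id.
Unshelve. all: by end_near. Qed.

Lemma calm_comp f a (h : R -> R) (L eps : R) : calm f a -> 0 < eps ->
  (forall u, `|u - f a| < eps -> `|h u - h (f a)| <= L * `|u - f a|) ->
  calm (h \o f) a.
Proof.
move=> fa e0 hL; have [K fK] := fa; exists (`|L| * K); near=> z.
apply: le_trans (hL _ _) _; first by near: z; exact: calm_near.
apply: (@le_trans _ _ (`|L| * `|f z - f a|)).
  by rewrite ler_wpM2r // ler_norm.
by rewrite -mulrA ler_wpM2l //; near: z.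
Unshelve. all: by end_near. Qed.

Lemma calmD f g a : calm f a -> calm g a -> calm (fun z => f z + g z) a.
Proof.
move=> [K fK] [L gL]; exists (K + L); near=> z.
rewrite opprD addrACA mulrDl (le_trans (ler_normD _ _)) // lerD //; by near: z.
Unshelve. all: by end_near. Qed.

Lemma calmM f g a : calm f a -> calm g a -> calm (fun z => f z * g z) a.
Proof.
move=> [K fK] ga; have [L gL] := ga; exists (K * (`|g a| + 1) + `|f a| * L); near=> z.
have -> : f z * g z - f a * g a = (f z - f a) * g z + f a * (g z - g a) by ring.
rewrite [leRHS]mulrDl (le_trans (ler_normD _ _)) // lerD // normrM; last first.
  by rewrite -mulrA ler_wpM2l //; near: z.
rewrite mulrAC ler_pM //; first by near: z.
rewrite -[g z](subrK (g a)) addrC (le_trans (ler_normD _ _)) // lerD2l ltW //.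
by near: z; exact: calm_near.
Unshelve. all: by end_near. Qed.

Lemma calmN f a : calm f a -> calm (fun z => - f z) a.
Proof.
move=> [K fK]; exists K; near=> z.
by rewrite -opprD normrN; near: z.
Unshelve. all: by end_near. Qed.

Lemma calmV f a : f a != 0 -> calm f a -> calm (fun z => (f z)^-1) a.
Proof.
move=> fa0 fa; have n0 : 0 < `|f a| by rewrite normr_gt0.
apply: (@calm_comp f a GRing.inv (2 / `|f a| ^+ 2) (`|f a| / 2)) => //.
  by rewrite divr_gt0.
move=> u uf.
have u2 : `|f a| / 2 < `|u|.
  have := ler_normB u (u - f a); rewrite subKr; lra.
have u0 : u != 0 by rewrite -normr_gt0; lra.
have -> : u^-1 - (f a)^-1 = (f a - u) / (u * f a) by field; rewrite fa0 u0.
rewrite normrM distrC mulrC ler_wpM2r // normfV normrM expr2.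
rewrite ler_pdivlMr ?mulr_gt0 // mulrC ler_pdivrMr ?mulr_gt0 //; last by lra.
by rewrite mulrA ler_pM2r //; lra.
Qed.

Lemma calm_sqrt f a : 0 < f a -> calm f a -> calm (fun z => Num.sqrt (f z)) a.
Proof.
move=> f0 fa.
apply: (@calm_comp f a Num.sqrt (Num.sqrt (f a))^-1 (f a)) => // u.
rewrite ltr_distl subrr => /andP[u0 _].
have s0 : 0 < Num.sqrt (f a) by rewrite sqrtr_gt0.
have t0 : 0 <= Num.sqrt u by exact: sqrtr_ge0.
have E : (Num.sqrt u - Num.sqrt (f a)) * (Num.sqrt u + Num.sqrt (f a)) = u - f a.
  by rewrite -subr_sqr !sqr_sqrtr // ltW.
rewrite -E normrM mulrCA ler_peMr // ger0_norm ?addr_ge0 ?(ltW s0) //.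
by rewrite mulrC ler_pdivlMr // mul1r lerDr.
Qed.

Lemma calm_sg f a : f a != 0 -> calm f a -> calm (fun z => Num.sg (f z)) a.
Proof.
move=> fa0 fa.
apply: (@calm_comp f a Num.sg 0 `|f a|) => //; first by rewrite normr_gt0.
move=> u; rewrite mul0r ltr_distl => /andP[h1 h2].
have [f0|f0] := ltP 0 (f a).
  rewrite !gtr0_sg ?subrr ?normr0 //; move: h1; rewrite gtr0_norm // subrr //.
have {}f0 : f a < 0 by rewrite lt_neqAle fa0.
rewrite !ltr0_sg ?subrr ?normr0 //; move: h2; rewrite ltr0_norm // subrr //.
Qed.

Lemma calm_sum (I : Type) (s : seq I) (P : pred I) (f : I -> V -> R) a :
  (forall i, calm (f i) a) -> calm (fun z => \sum_(i <- s | P i) f i z) a.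
Proof.
move=> fa; elim: s => [|i s IH].
  by apply: (eq_calm (fun z => big_nil _ _ _ _)); exact: calm_cst.
apply: (eq_calm (fun z => big_cons _ _ _ _ _ _)).
by case: (P i) => //; exact: calmD.
Qed.

Lemma calm_prod (I : Type) (s : seq I) (P : pred I) (f : I -> V -> R) a :
  (forall i, calm (f i) a) -> calm (fun z => \prod_(i <- s | P i) f i z) a.
Proof.
move=> fa; elim: s => [|i s IH].
  by apply: (eq_calm (fun z => big_nil _ _ _ _)); exact: calm_cst.
apply: (eq_calm (fun z => big_cons _ _ _ _ _ _)).
by case: (P i) => //; exact: calmM.
Qed.

Lemma calm_bounded f a (B : R) : calm f a -> (forall z, `|f z| <= B) ->
  exists L, forall z, `|f z - f a| <= L * `|z - a|.
Proof.
move=> [L /nbhs_ballP[r /= r0 fL]] fB.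
exists (`|L| + 2 * B / r) => z.
have B0 : 0 <= B by exact: le_trans (fB a).
have [zr|rz] := ltP `|z - a| r.
  apply: le_trans (fL z _) _; first by rewrite -ball_normE /= distrC.
  by rewrite ler_wpM2r // (le_trans (ler_norm L)) // lerDl divr_ge0 ?mulr_ge0 // ltW.
apply: (@le_trans _ _ (2 * B)).
  by rewrite (le_trans (ler_normB _ _)) // mulr2n mulrDl mul1r lerD.
apply: (@le_trans _ _ (2 * B / r * `|z - a|)).
  rewrite mulrAC ler_pdivlMr // ler_wpM2l // mulr_ge0 //.
by rewrite ler_wpM2r // lerDr.
Qed.

End Calm.

Section MatrixNorm.
Variable R : realType.

Lemma mx_entry_le_norm m n (A : 'M[R]_(m, n)) i j : `|A i j| <= `|A|.
Proof.
rewrite [leRHS]/Num.Def.normr /= mx_normrE.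
by apply/bigmax_geP; right; exists (i, j).
Qed.

Lemma mx_norm_le m n (A : 'M[R]_(m, n)) (c : R) :
  0 <= c -> (forall i j, `|A i j| <= c) -> `|A| <= c.
Proof.
move=> c0 Ac; rewrite [leLHS]/Num.Def.normr /= mx_normrE.
by apply: bigmax_le => // -[i j] _; exact: Ac.
Qed.

Lemma calm_entry m n (A : 'M[R]_(m, n)) i j : calm (fun M : 'M[R]_(m, n) => M i j) A.
Proof.
exists 1; near=> M; rewrite mul1r (le_trans _ (mx_entry_le_norm _ i j)) //.
by rewrite !mxE.
Unshelve. all: by end_near. Qed.

End MatrixNorm.

Section CalmGSOP.
Variable R : realType.
Notation M3 := 'M[R]_3.
Implicit Types (f g : M3 -> 'cV[R]_3) (Z : M3).

Let calmc f Z := forall i, calm (fun M => f M i 0) Z.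

Lemma calm_col j Z : calmc (col j) Z.
Proof. by move=> i; apply: (eq_calm (fun M => mxE _ _ _ _)); exact: calm_entry. Qed.

Lemma calm_dot f g Z : calmc f Z -> calmc g Z -> calm (fun M => dot (f M) (g M)) Z.
Proof.
move=> cf cg; apply: (eq_calm (fun M => dotE _ _)).
by do 2?[apply: calmD]; apply: calmM.
Qed.

Lemma calm_scale (h : M3 -> R) f Z : calm h Z -> calmc f Z ->
  calmc (fun M => h M *: f M) Z.
Proof.
by move=> ch cf i; apply: (eq_calm (fun M => mxE _ _ _ _)); exact: calmM.
Qed.

Lemma calm_colB f g Z : calmc f Z -> calmc g Z -> calmc (fun M => f M - g M) Z.
Proof.
move=> cf cg i; apply: (@eq_calm _ _ _ (fun M => f M i 0 - g M i 0)) => [M|].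
  by rewrite !mxE.
by apply: calmD; last exact: calmN.
Qed.

Lemma calm_normalize f Z : enorm (f Z) != 0 -> calmc f Z ->
  calmc (fun M => normalize (f M)) Z.
Proof.
move=> f0 cf; apply: calm_scale => //; apply: calmV => //.
apply: calm_sqrt; last exact: calm_dot.
by rewrite -enorm_sqr exprn_even_gt0.
Qed.

Lemma calm_GSOP Z i j : Z \in unitmx -> calm (fun M => GSOP M i j) Z.
Proof.
move=> /gs_residuals_neq0[n1 n2 n3 d0].
have c1 := calm_normalize n1 (calm_col 0 Z).
have c2 : calmc (fun M => normalize (gs2_residual M)) Z.
  apply: calm_normalize => //; apply: calm_colB; first exact: calm_col.
  by apply: calm_scale => //; apply: calm_dot => //; exact: calm_col.
have c3 : calmc (fun M => normalize (gs3_residual M)) Z.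
  apply: calm_normalize => //; apply: calm_colB; first apply: calm_colB.
  - exact: calm_col.
  - by apply: calm_scale => //; apply: calm_dot => //; exact: calm_col.
  - by apply: calm_scale => //; apply: calm_dot => //; exact: calm_col.
have ce a b : calm (fun M => gs_frame M a b) Z.
  by apply: (eq_calm (fun M => mxE _ _ _ _)); elim/ord3P: b => /=.
have cd : calm (fun M => \det (gs_frame M)) Z.
  apply: calm_sum => s; apply: calmM; first exact: calm_cst.
  by apply: calm_prod => k; exact: ce.
apply: (eq_calm (fun M => mxE _ _ _ _)).
elim/ord3P: j => //=.
by apply: calm_scale => //; exact: calm_sg.
Qed.

(** Calmness gives the bound near Z, and the boundedness of the output gives it
    far from Z.  Having it for all M covers the initial times, when the matrix
    given to the procedure may still be far from its limit or singular. *)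
Lemma GSOP_lipschitz_at Z : Z \in unitmx ->
  exists L, forall M, `|GSOP M - GSOP Z| <= L * `|M - Z|.
Proof.
move=> Zu.
have /choice[L LP] : forall ij : 'I_3 * 'I_3, exists L, forall M,
    `|GSOP M ij.1 ij.2 - GSOP Z ij.1 ij.2| <= L * `|M - Z|.
  move=> [i j]; apply: (calm_bounded (calm_GSOP i j Zu) (B := 1)) => M.
  exact: GSOP_entry_le1.
exists (\sum_ij `|L ij|) => M; apply: mx_norm_le => [|i j].
  by rewrite mulr_ge0 // sumr_ge0.
have := LP (i, j) M; rewrite !mxE; move/le_trans; apply; rewrite ler_wpM2r //.
by rewrite (le_trans (ler_norm _)) // (bigD1 (i, j)) //= lerDl sumr_ge0.
Qed.

End CalmGSOP.

(** * Lebesgue-null sets *)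

Section NullSets.
Variables (R : realType) (I : finType).
Implicit Types (A : set (I -> R)) (a b : I -> R) (z : I -> R).

Definition box a b : set (I -> R) := [set x | forall i, a i <= x i <= b i].
Definition volume a b : R := \prod_i (b i - a i).

Lemma volume_ge0 a b : (forall i, a i <= b i) -> 0 <= volume a b.
Proof. by move=> ab; apply: prodr_ge0 => i _; rewrite subr_ge0. Qed.

(** Outer measure zero, with the covers in place of their infimum, so that the
    covers of countably many sets can be merged into one. *)
Definition thin A : Prop := forall eps : R, 0 < eps ->
  exists a b : nat -> I -> R, [/\ forall k i, a k i <= b k i,
    A `<=` \bigcup_k box (a k) (b k) &
    (\sum_(0 <= k <oo) (volume (a k) (b k))%:E <= eps%:E)%E].

Lemma thin_null A : thin A -> lebesgue_null A.
Proof.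
move=> tA; apply/eqP; rewrite eq_le; apply/andP; split.
  apply/lee_addgt0Pr => eps e0; rewrite add0e.
  have [a [b [ab Ab s]]] := tA eps e0; apply: ge_ereal_inf.
  by eexists; last exact: s; exists a, b.
apply: le_ereal_inf_tmp => _ [a [b [ab _ ->]]].
by apply: nneseries_ge0 => k _ _; rewrite lee_fin volume_ge0.
Qed.

Lemma thinS A B : A `<=` B -> thin B -> thin A.
Proof.
move=> AB tB eps e0; have [a [b [ab Bb s]]] := tB eps e0.
by exists a, b; split=> //; exact: subset_trans Bb.
Qed.

(** The k-th set gets a cover of volume eps / 2^(k+1); a bijection between
    nat * nat and nat merges the covers. *)
Lemma thin_bigcup (A : nat -> set (I -> R)) :
  (forall k, thin (A k)) -> thin (\bigcup_k A k).
Proof.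
move=> tA eps e0.
have e2 k : 0 < eps / (2 ^ k.+1)%:R by rewrite divr_gt0 // ltr0n expn_gt0.
have /choice[a /choice[b ab]] := fun k => tA k _ (e2 k).
have /card_set_bijP[h] := card_nat2; rewrite setTT_bijective => -[g hK gK].
exists (fun m => a (g m).1 (g m).2), (fun m => b (g m).1 (g m).2); split.
- by move=> m i; have [+ _ _] := ab (g m).1; exact.
- move=> x [k _ Akx]; have [_ + _] := ab k => /(_ x Akx)[l _ xl].
  by exists (h (k, l)) => //=; rewrite hK.
have v0 k l : (0 <= (volume (a k l) (b k l))%:E)%E.
  by rewrite lee_fin volume_ge0 // => i; have [+ _ _] := ab k; exact.
rewrite nneseries_esumT //.
rewrite (@reindex_esum _ _ _ setT setT h); last first.
  by rewrite setTT_bijective; exists g.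
under eq_esum do rewrite hK.
have -> : [set: nat * nat] = [set: nat] `*`` (fun=> [set: nat]).
  by apply/seteqP; split.
rewrite -(esum_esum (a := fun k l => (volume (a k l) (b k l))%:E)) //.
apply: le_trans (epsilon_trick0 xpredT (ltW e0)).
rewrite (@nneseries_esumT _ (fun k => (eps / (2 ^ k.+1)%:R)%:E)); last first.
  by move=> k; rewrite lee_fin ltW ?e2.
apply: le_esum => k _; rewrite -nneseries_esumT //.
by have [] := ab k.
Qed.

Lemma thin_fin_cover A (i0 : I) :
  (forall eps : R, 0 < eps -> exists (T : finType) (a b : T -> I -> R),
     [/\ forall t i, a t i <= b t i, A `<=` \bigcup_t box (a t) (b t) &
         \sum_t volume (a t) (b t) <= eps]) ->
  thin A.
Proof.
move=> cA eps e0; have [T [a [b [ab Ab s]]]] := cA eps e0.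
(* The cover is continued after its last box by copies of a degenerate box. *)
pose ext (f : T -> I -> R) k := nth (fun=> 0) [seq f t | t <- enum T] k.
have extE f t : ext f (index t (enum T)) = f t.
  by rewrite /ext (nth_map t) ?index_mem ?mem_enum // nth_index ?mem_enum.
have ext0 f k : (size (enum T) <= k)%N -> ext f k = fun=> 0.
  by move=> k0; rewrite /ext nth_default // size_map.
have ext_le k i : ext a k i <= ext b k i.
  have [k0|kT] := leqP (size (enum T)) k; first by rewrite !ext0.
  have [t <-] : exists t, index t (enum T) = k.
    have [t0 _] : exists t0 : T, true.
      by case: (enum T) kT => // t0 _; exists t0.
    by exists (nth t0 (enum T) k); rewrite index_uniq // enum_uniq.
  by rewrite !extE.
exists (ext a), (ext b); split=> //.
  move=> x /Ab[t _ xt]; exists (index t (enum T)) => //; by rewrite !extE.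
rewrite (nneseries_split 0 (size (enum T))); last first.
  by move=> k _; rewrite lee_fin volume_ge0.
rewrite add0n [X in (_ + X)%E]eseries0 ?adde0; last first.
  move=> k kT _; rewrite !ext0 //; congr (_%:E).
  by rewrite /volume (bigD1 i0) //= subrr mul0r.
rewrite sumEFin lee_fin; apply: le_trans s.
rewrite -[X in _ <= X]big_enum /=.
have [t0 _|T0] := pickP T; last first.
  have -> : enum T = [::] by apply/size0nil; rewrite -cardE; exact: eq_card0.
  by rewrite big_nil big_geq.
rewrite [X in _ <= X](big_nth t0) big_nat [X in _ <= X]big_nat.
apply: ler_sum => k /andP[_ kT].
by rewrite -(extE a) -(extE b) index_uniq ?enum_uniq.
Qed.

Definition cube (B : R) : set (I -> R) := [set z | forall i, `|z i| <= B].

(** The slack delta is imposed on the coordinates other than i0 only, so that g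
    is at once locally Lipschitz and independent of the coordinate i0. *)
Definition loclip (i0 : I) (g : (I -> R) -> R) : Prop := forall B : R, 0 <= B ->
  exists L, forall z z' delta, cube B z -> cube B z' ->
    (forall i, i != i0 -> `|z i - z' i| <= delta) -> 0 <= delta ->
    `|g z - g z'| <= L * delta.

Section LoclipTheory.
Variable i0 : I.

Lemma loclip_cst (c : R) : loclip i0 (fun=> c).
Proof. by move=> B _; exists 0 => z z' d *; rewrite subrr normr0 mul0r. Qed.

Lemma loclip_coord i : i != i0 -> loclip i0 (fun z => z i).
Proof. by move=> ii0 B _; exists 1 => z z' d _ _ zz _; rewrite mul1r zz. Qed.

Lemma loclipD g h : loclip i0 g -> loclip i0 h -> loclip i0 (fun z => g z + h z).
Proof.
move=> lg lh B B0; have [[K gK] [L hL]] := (lg B B0, lh B B0).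
exists (K + L) => z z' d zB z'B zz d0; rewrite opprD addrACA mulrDl.
by rewrite (le_trans (ler_normD _ _)) // lerD // (gK, hL).
Qed.

Lemma loclip_bounded g B : loclip i0 g -> 0 <= B ->
  exists C, forall z, cube B z -> `|g z| <= C.
Proof.
move=> lg B0; have [L gL] := lg B B0.
exists (`|g (fun=> 0)| + L * B) => z zB.
rewrite -[g z](subrK (g (fun=> 0))) addrC (le_trans (ler_normD _ _)) // lerD2l.
by apply: gL => // i; rewrite ?normr0 ?subr0.
Qed.

Lemma loclipM g h : loclip i0 g -> loclip i0 h -> loclip i0 (fun z => g z * h z).
Proof.
move=> lg lh B B0; have [[K gK] [L hL]] := (lg B B0, lh B B0).
have [[C gC] [D hD]] := (loclip_bounded lg B0, loclip_bounded lh B0).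
exists (K * D + C * L) => z z' d zB z'B zz d0.
have -> : g z * h z - g z' * h z' = (g z - g z') * h z + g z' * (h z - h z') by ring.
rewrite [leRHS]mulrDl (le_trans (ler_normD _ _)) // lerD // normrM.
  by rewrite mulrAC ler_pM // (gK, hD).
by rewrite -mulrA ler_pM // (gC, hL).
Qed.

Lemma loclip_sum (J : Type) (s : seq J) (P : pred J) (g : J -> (I -> R) -> R) :
  (forall j, P j -> loclip i0 (g j)) ->
  loclip i0 (fun z => \sum_(j <- s | P j) g j z).
Proof.
move=> lg; elim: s => [|j s IH].
  have -> : (fun z => \sum_(j <- [::] | P j) g j z) = fun=> 0.
    by apply/funext => z; rewrite big_nil.
  exact: loclip_cst.
have -> : (fun z => \sum_(k <- j :: s | P k) g k z) = (fun z =>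
    if P j then g j z + \sum_(k <- s | P k) g k z else \sum_(k <- s | P k) g k z).
  by apply/funext => z; rewrite big_cons.
by have := lg j; case: (P j) => // /(_ isT) lj; exact: loclipD.
Qed.

Lemma grid_cell (N : nat) (B y : R) : 0 < B -> `|y| <= B ->
  exists k : 'I_N.+1, `|y - (k%:R * (2 * B / N.+1%:R) - B)| <= 2 * B / N.+1%:R.
Proof.
move=> B0; rewrite ler_norml => /andP[y1 y2].
have N0 : 0 < N.+1%:R :> R by rewrite ltr0n.
pose h := 2 * B / N.+1%:R; have h0 : 0 < h by rewrite divr_gt0 // mulr_gt0.
have hN : h * N.+1%:R = 2 * B by rewrite divfK // gt_eqF.
have u0 : 0 <= (y + B) / h by rewrite divr_ge0 ?(ltW h0) //; lra.
have uE : (y + B) / h * h = y + B by rewrite divfK // gt_eqF.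
have /andP[k1 k2] := truncn_itv u0.
have k1h := ler_wpM2r (ltW h0) k1; have k2h := ler_wpM2r (ltW h0) (ltW k2).
rewrite uE in k1h k2h; rewrite -natr1 mulrDl mul1r in k2h.
have [kN|Nk] := ltnP (Num.truncn ((y + B) / h)) N.+1.
  by exists (Ordinal kN); rewrite /= -/h ler_norml; apply/andP; split; lra.
(* The right end of the interval belongs to the last cell. *)
exists ord_max; rewrite /= -/h ler_norml.
have : N.+1%:R * h <= (Num.truncn ((y + B) / h))%:R * h.
  by rewrite ler_wpM2r ?ler_nat // ltW.
move: hN; rewrite -natr1 mulrDl mul1r [h * _]mulrDr mulr1 [h * _]mulrC => hN Nh.
by apply/andP; split; lra.
Qed.

(** A cube is cut along the coordinates other than i0 into N^(d-1) cells of
    width of order 1/N, and the image of each cell fits in a cube of volume of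
    order N^(-d); the total volume is of order 1/N. *)
Lemma thin_image_cube (f : (I -> R) -> (I -> R)) (B : R) :
  (forall i, loclip i0 (fun z => f z i)) -> 0 < B -> thin (f @` cube B).
Proof.
move=> lf B0.
have /choice[L fL] := fun i => lf i B (ltW B0).
pose M := \sum_i `|L i| + 1.
have M0 : 0 < M by rewrite ltr_wpDl // sumr_ge0.
have LM i : L i <= M.
  rewrite (le_trans (ler_norm _)) // /M (bigD1 i) //= -addrA lerDl.
  by rewrite addr_ge0 // sumr_ge0.
apply: (thin_fin_cover i0) => eps e0.
(* A box around the image of a cell has sides 2 M h = c / N.+1. *)
pose c := 4 * M * B; have c0 : 0 < c by rewrite !mulr_gt0.
have ce : 0 <= c ^+ #|I| / eps by rewrite divr_ge0 ?exprn_ge0 ?ltW.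
pose N := Num.truncn (c ^+ #|I| / eps).
have N0 : 0 < N.+1%:R :> R by rewrite ltr0n.
pose h := 2 * B / N.+1%:R; have h0 : 0 < h by rewrite divr_gt0 // mulr_gt0.
pose J : finType := {i : I | i != i0}.
pose ctr (g : {ffun J -> 'I_N.+1}) : I -> R := fun i =>
  if insub i is Some j then (g j)%:R * h - B else 0.
exists {ffun J -> 'I_N.+1}, (fun g i => f (ctr g) i - M * h),
  (fun g i => f (ctr g) i + M * h); split.
- by move=> g i; rewrite lerD2l ge0_cp // mulr_ge0 // ltW.
- move=> _ [z zB <-].
  have /choice[g0 g0P] : forall j : J, exists k : 'I_N.+1,
      `|z (val j) - (k%:R * h - B)| <= h.
    by move=> j; exact: grid_cell.
  exists [ffun j => g0 j] => // i.
  rewrite -ler_distlC distrC; apply: le_trans (_ : _ <= L i * h) _; last first.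
    by rewrite ler_wpM2r // ltW.
  apply: fL => //; last exact: ltW.
    move=> k; rewrite /ctr; case: insubP => [j _ _|_]; last by rewrite normr0 ltW.
    rewrite ffunE ler_norml.
    have k0 : 0 <= (g0 j)%:R :> R by [].
    have k1 : (g0 j)%:R <= N.+1%:R :> R by rewrite ler_nat ltnW.
    have hN : N.+1%:R * h = 2 * B by rewrite mulrC divfK // gt_eqF.
    apply/andP; split; nra.
  move=> k ki0; rewrite /ctr; case: insubP => [j _ <-|]; last by rewrite ki0.
  by rewrite ffunE; exact: g0P.
have vE g : volume (fun i => f (ctr g) i - M * h) (fun i => f (ctr g) i + M * h) =
    (c / N.+1%:R) ^+ #|I|.
  rewrite /volume -prodr_const; apply: eq_bigr => i _.
  by rewrite opprB addrC addrA subrK /c /h; field; rewrite gt_eqF.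
under eq_bigr do rewrite vE.
rewrite sumr_const card_ffun card_ord card_sig -[_ *+ _]mulr_natl natrX.
have -> : #|[pred i | i != i0]| = #|I|.-1 by rewrite -(cardC1 i0); exact: eq_card.
have I0 : (0 < #|I|)%N by apply/card_gt0P; exists i0.
rewrite expr_div_n -{2 3}(prednK I0) [N.+1%:R ^+ _.+1]exprS prednK //.
have P0 : 0 < N.+1%:R ^+ #|I|.-1 :> R by rewrite exprn_gt0.
have -> : N.+1%:R ^+ #|I|.-1 * (c ^+ #|I| / (N.+1%:R * N.+1%:R ^+ #|I|.-1)) =
    c ^+ #|I| / N.+1%:R.
  by field; rewrite !gt_eqF.
rewrite ler_pdivrMr // mulrC -ler_pdivrMr //.
by have /andP[_ /ltW] := truncn_itv ce.
Qed.

Theorem thin_image (f : (I -> R) -> (I -> R)) :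
  (forall i, loclip i0 (fun z => f z i)) -> thin (range f).
Proof.
move=> lf; apply: (@thinS _ (\bigcup_k f @` cube k.+1%:R)); last first.
  by apply: thin_bigcup => k; apply: thin_image_cube.
move=> _ [z _ <-]; pose s := \sum_i `|z i|.
have s0 : 0 <= s by exact: sumr_ge0.
exists (Num.truncn s) => //; exists z => // i.
apply: (@le_trans _ _ s); first by rewrite /s (bigD1 i) //= lerDl sumr_ge0.
by have /andP[_ /ltW] := truncn_itv s0.
Qed.

End LoclipTheory.

Lemma hyperplane_thin (c : I -> R) (i0 : I) : c i0 != 0 ->
  thin [set x | \sum_i c i * x i = 0].
Proof.
move=> ci0.
pose f z i := if i == i0 then - (c i0)^-1 * \sum_(j | j != i0) c j * z j else z i.
apply: (@thinS _ (range f)); last first.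
  apply: (@thin_image i0) => i; rewrite /f; have [_|ii0] := eqVneq i i0.
    apply: loclipM; first exact: loclip_cst.
    apply: loclip_sum => j ji0.
    by apply: loclipM; [exact: loclip_cst|exact: loclip_coord].
  exact: loclip_coord.
move=> x /= xc; exists x => //; apply/funext => i; rewrite /f.
have [->|//] := eqVneq i i0.
move: xc; rewrite (bigD1 i0) //= addrC => /eqP; rewrite addr_eq0 => /eqP->.
by rewrite mulrNN mulKf.
Qed.

End NullSets.

(** * Exponential convergence of matrix-valued functions *)

Section ExpConvergence.
Variable R : realType.

Lemma mx_norm_mul_le m n p (A : 'M[R]_(m, n)) (B : 'M[R]_(n, p)) :
  `|A *m B| <= n%:R * `|A| * `|B|.
Proof.
apply: mx_norm_le => [|i j]; first by rewrite !mulr_ge0.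
rewrite mxE (le_trans (ler_norm_sum _ _ _)) //.
rewrite -mulrA mulr_natl -[X in _ *+ X](card_ord n) -sumr_const.
by apply: ler_sum => k _; rewrite normrM ler_pM // mx_entry_le_norm.
Qed.

Lemma mx_norm_tr m n (A : 'M[R]_(m, n)) : `|A^T| = `|A|.
Proof.
apply/eqP; rewrite eq_le; apply/andP; split; apply: mx_norm_le => // i j.
  by rewrite mxE mx_entry_le_norm.
by have := mx_entry_le_norm A^T j i; rewrite mxE.
Qed.

Implicit Types m n k : nat.

Lemma exp_cvg_eq m n (f g f' g' : R -> 'M[R]_(m, n)) :
  (forall t, 0 <= t -> f t = f' t) -> (forall t, 0 <= t -> g t = g' t) ->
  exp_cvg f' g' -> exp_cvg f g.
Proof.
move=> ff gg [c [l [l0 H]]]; exists c, l; split=> // t t0.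
by rewrite ff // gg // H.
Qed.

Lemma exp_cvg_const_ge0 m n (f g : R -> 'M[R]_(m, n)) (c l : R) :
  (forall t, 0 <= t -> `|f t - g t| <= c * expR (- (l * t))) -> 0 <= c.
Proof.
move=> /(_ 0 (lexx 0)); rewrite mulr0 oppr0 expR0 mulr1; exact: le_trans.
Qed.

Lemma exp_cvg_trans m n (f g h : R -> 'M[R]_(m, n)) :
  exp_cvg f g -> exp_cvg g h -> exp_cvg f h.
Proof.
move=> [c [l [l0 fg]]] [d [k [k0 gh]]].
exists (c + d), (Num.min l k); split=> [|t t0]; first by rewrite lt_min l0.
rewrite -[f t](subrK (g t)) -addrA (le_trans (ler_normD _ _)) // mulrDl.
apply: lerD.
  apply: le_trans (fg t t0) _; rewrite ler_wpM2l ?(exp_cvg_const_ge0 fg) //.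
  by rewrite ler_expR lerN2 ler_wpM2r // ge_min lexx.
apply: le_trans (gh t t0) _; rewrite ler_wpM2l ?(exp_cvg_const_ge0 gh) //.
by rewrite ler_expR lerN2 ler_wpM2r // ge_min lexx orbT.
Qed.

Lemma exp_cvg_dominated m n m' n' (f g : R -> 'M[R]_(m, n))
    (f' g' : R -> 'M[R]_(m', n')) (L : R) :
  (forall t, 0 <= t -> `|f' t - g' t| <= L * `|f t - g t|) ->
  exp_cvg f g -> exp_cvg f' g'.
Proof.
move=> FL [c [l [l0 fg]]]; exists (`|L| * c), l; split=> // t t0.
apply: le_trans (FL t t0) _; apply: (@le_trans _ _ (`|L| * `|f t - g t|)).
  by rewrite ler_wpM2r // ler_norm.
by rewrite -mulrA ler_wpM2l // fg.
Qed.

Lemma subexponential_bounded m n (f : R -> 'M[R]_(m, n)) (c : R) :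
  (forall t, 0 <= t -> `|f t| <= c) -> subexponential f.
Proof.
move=> fc eps e0; exists c => t t0; apply: le_trans (fc t t0) _.
have c0 : 0 <= c by exact: le_trans (fc t t0).
by rewrite ler_peMr // -expR0 ler_expR mulr_ge0 // ltW.
Qed.

Lemma exp_cvg_subexponential m n (f : R -> 'M[R]_(m, n)) (a : 'M[R]_(m, n)) :
  exp_cvg f (fun=> a) -> subexponential f.
Proof.
move=> [c [l [l0 fa]]]; apply: (subexponential_bounded (c := c + `|a|)) => t t0.
rewrite -[f t](subrK a) (le_trans (ler_normD _ _)) // lerD2r.
apply: le_trans (fa t t0) _; rewrite ler_piMr ?(exp_cvg_const_ge0 fa) //.
by rewrite -expR0 ler_expR oppr_le0 mulr_ge0 // ltW.
Qed.

(** Half of the rate pays for the growth of the factor. *)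
Lemma exp_cvg_mulr m n k (f g : R -> 'M[R]_(m, n)) (h : R -> 'M[R]_(n, k)) :
  exp_cvg f g -> subexponential h ->
  exp_cvg (fun t => f t *m h t) (fun t => g t *m h t).
Proof.
move=> [c [l [l0 fg]]] hs; have l2 : 0 < l / 2 by rewrite divr_gt0.
have [d hd] := hs _ l2; exists (n%:R * c * d), (l / 2); split=> // t t0.
rewrite -mulmxBl (le_trans (mx_norm_mul_le _ _)) //.
have -> : expR (- (l / 2 * t)) = expR (- (l * t)) * expR (l / 2 * t).
  by rewrite -expRD; congr expR; field.
have -> (a b : R) : n%:R * c * d * (a * b) = n%:R * (c * a * (d * b)) by ring.
rewrite -mulrA ler_wpM2l //.
by apply: ler_pM => //; [exact: fg|exact: hd].
Qed.

Lemma exp_cvg_mul_cst m n k (f : R -> 'M[R]_(m, n)) (g : R -> 'M[R]_(n, k)) a b :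
  exp_cvg f (fun=> a) -> exp_cvg g (fun=> b) ->
  exp_cvg (fun t => f t *m g t) (fun=> a *m b).
Proof.
move=> fa gb; apply: exp_cvg_trans (exp_cvg_mulr fa (exp_cvg_subexponential gb)) _.
apply: (exp_cvg_dominated (L := n%:R * `|a|)) gb => t _.
by rewrite -mulmxBr mx_norm_mul_le.
Qed.

Lemma exp_cvg_tr m n (f g : R -> 'M[R]_(m, n)) :
  exp_cvg f g -> exp_cvg (fun t => (f t)^T) (fun t => (g t)^T).
Proof.
apply: (exp_cvg_dominated (L := 1)) => t _.
by rewrite -linearB /= mx_norm_tr mul1r.
Qed.

Lemma exp_cvgN m n (f g : R -> 'M[R]_(m, n)) :
  exp_cvg f g -> exp_cvg (fun t => - f t) (fun t => - g t).
Proof.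
apply: (exp_cvg_dominated (L := 1)) => t _.
by rewrite -opprD normrN mul1r.
Qed.

Lemma exp_cvg_ulsub m n m' n' (f g : R -> 'M[R]_(m + m', n + n')) :
  exp_cvg f g -> exp_cvg (fun t => ulsubmx (f t)) (fun t => ulsubmx (g t)).
Proof.
apply: (exp_cvg_dominated (L := 1)) => t _; rewrite mul1r.
apply: mx_norm_le => // i j.
by have := mx_entry_le_norm (f t - g t) (lshift m' i) (lshift n' j); rewrite !mxE.
Qed.

Lemma exp_cvg_ursub m n m' n' (f g : R -> 'M[R]_(m + m', n + n')) :
  exp_cvg f g -> exp_cvg (fun t => ursubmx (f t)) (fun t => ursubmx (g t)).
Proof.
apply: (exp_cvg_dominated (L := 1)) => t _; rewrite mul1r.
apply: mx_norm_le => // i j.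
by have := mx_entry_le_norm (f t - g t) (lshift m' i) (rshift n j); rewrite !mxE.
Qed.

Lemma exp_cvg_entries m n (f g : R -> 'M[R]_(m, n)) (l : R) : 0 < l ->
  (forall i j, exists c, forall t, 0 <= t ->
     `|f t i j - g t i j| <= c * expR (- (l * t))) ->
  exp_cvg f g.
Proof.
move=> l0 H; have /choice[c cP] : forall ij, exists c, forall t, 0 <= t ->
     `|f t ij.1 ij.2 - g t ij.1 ij.2| <= c * expR (- (l * t)) by case.
exists (\sum_ij `|c ij|), l; split=> // t t0.
apply: mx_norm_le => [|i j]; first by rewrite mulr_ge0 ?expR_ge0 ?sumr_ge0.
have := cP (i, j) t t0; rewrite !mxE => /le_trans; apply.
rewrite ler_wpM2r ?expR_ge0 // (le_trans (ler_norm _)) // (bigD1 (i, j)) //=.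
by rewrite lerDl sumr_ge0.
Qed.

End ExpConvergence.

(** * Poses *)

Section Poses.
Variable R : realType.
Implicit Types (A B : 'M[R]_3) (a b : 'cV[R]_3).

Lemma pose_norm_sub A B a b : `|pose A a - pose B b| <= `|A - B| + `|a - b|.
Proof.
apply: mx_norm_le => [|i j]; first exact: addr_ge0.
rewrite /pose opp_block_mx add_block_mx subrr subrr.
case: (split_ordP i) => k ->; case: (split_ordP j) => l ->.
- by rewrite block_mxEul ler_wpDr // mx_entry_le_norm.
- by rewrite block_mxEur ler_wpDl // mx_entry_le_norm.
- by rewrite block_mxEdl mxE normr0 addr_ge0.
- by rewrite block_mxEdr mxE normr0 addr_ge0.
Qed.

Lemma exp_cvg_pose (f g : R -> 'M[R]_3) (h k : R -> 'cV[R]_3) :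
  exp_cvg f g -> exp_cvg h k ->
  exp_cvg (fun t => pose (f t) (h t)) (fun t => pose (g t) (k t)).
Proof.
move=> fg hk; apply: (exp_cvg_trans (g := fun t => pose (g t) (h t))).
  apply: (exp_cvg_dominated (L := 1)) fg => t _.
  by rewrite mul1r (le_trans (pose_norm_sub _ _ _ _)) // subrr normr0 addr0.
apply: (exp_cvg_dominated (L := 1)) hk => t _.
by rewrite mul1r (le_trans (pose_norm_sub _ _ _ _)) // subrr normr0 add0r.
Qed.

Lemma pose_mul A B a b : pose A a *m pose B b = pose (A *m B) (A *m b + a).
Proof. by rewrite mulmx_block !(mulmx0, mul0mx, mulmx1, addr0, add0r). Qed.

Lemma pose1 : pose 1%:M 0 = 1%:M :> 'M[R]_(3 + 1).
Proof. by rewrite [RHS]scalar_mx_block. Qed.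

Lemma pose_unit_inv A a : SO3 A ->
  pose A a \in unitmx /\ invmx (pose A a) = pose A^T (- (A^T *m a)).
Proof.
move=> [AA _].
have E : pose A^T (- (A^T *m a)) *m pose A a = 1%:M.
  by rewrite pose_mul AA subrr pose1.
have [_ U] := mulmx1_unit E; split=> //.
by rewrite -[RHS]mulmx1 -(mulmxV U) mulmxA E mul1mx.
Qed.

Lemma SO3_mulmx_tr A : SO3 A -> A *m A^T = 1%:M.
Proof. by move=> [/mulmx1C]. Qed.

Lemma SO3_norm_le1 A : SO3 A -> `|A| <= 1.
Proof.
move=> [AA _]; apply: mx_norm_le => // i j.
have := congr1 (fun M : 'M[R]_3 => M j j) AA; rewrite !mxE eqxx mulr1n sum3 !mxE => E.
rewrite -(@ler_pXn2r _ 2) ?nnegrE // expr1n -normrX ger0_norm ?sqr_ge0 // -E.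
move: (sqr_ge0 (A 0 j)) (sqr_ge0 (A 1 j)) (sqr_ge0 (A 2 j)); rewrite -!expr2.
by elim/ord3P: i => *; lra.
Qed.

Lemma pose_subexponential (f : R -> 'M[R]_3) (h : R -> 'cV[R]_3) :
  subexponential f -> subexponential h -> subexponential (fun t => pose (f t) (h t)).
Proof.
move=> fs hs eps e0; have [[c fc] [d hd]] := (fs _ e0, hs _ e0).
exists (c + d + 1) => t t0.
have -> : pose (f t) (h t) = (pose (f t) (h t) - pose 0 0) + pose 0 0 by rewrite subrK.
rewrite (le_trans (ler_normD _ _)) // [leRHS]mulrDl lerD //.
  rewrite (le_trans (pose_norm_sub _ _ _ _)) // !subr0 mulrDl.
  by rewrite lerD // (fc, hd).
rewrite mul1r; apply: (@le_trans _ _ 1).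
  apply: mx_norm_le => // i j; rewrite /pose.
  case: (split_ordP i) => k ->; case: (split_ordP j) => l ->;
    rewrite ?(block_mxEul, block_mxEur, block_mxEdl, block_mxEdr) mxE ?normr0 //.
  by rewrite !ord1 eqxx normr1.
by rewrite -expR0 ler_expR mulr_ge0 // ltW.
Qed.

End Poses.

(** * Singular consensus matrices *)

Lemma singular_column (F : fieldType) (m : nat) (M : 'M[F]_m) : \det M = 0 ->
  exists (k : 'I_m) (c : 'I_m -> F),
    forall i, M i k = \sum_(j | j != k) c j * M i j.
Proof.
rewrite -det_tr => /eqP/det0P[v v0 vM].
have [k vk] : exists k, v 0 k != 0.
  apply/existsP; apply: contraNT v0 => /existsPn v0; apply/eqP/rowP => k.
  by rewrite mxE; apply/eqP; have := v0 k; rewrite negbK.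
exists k, (fun j => - (v 0 k)^-1 * v 0 j) => i.
have := congr1 (fun M : 'rV_m => M 0 i) vM; rewrite !mxE (bigD1 k) //= mxE.
move=> /eqP; rewrite addr_eq0 => /eqP E.
apply: (mulfI vk); rewrite E mulr_sumr -sumrN; apply: eq_bigr => j _.
by rewrite mxE; field.
Qed.

Section SingularConsensus.
Variables (R : realType) (n : nat) (w : 'rV[R]_n) (A : 'I_n -> 'M[R]_3).
Variable i0 : 'I_n.

(** A parametrization of the singular matrices whose column k depends on the two
    others.  The coefficients of the dependence are read in the off-diagonal
    entries of column k itself, so that z at (k, k) is the ignored coordinate. *)
Definition singular_block (k : 'I_3) (z : init_index n -> R) : 'M[R]_3 :=
  \matrix_(a, b) if b == k
    then \sum_(j | j != k) z (i0, inl (j, k)) * z (i0, inl (a, j))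
    else z (i0, inl (a, b)).

(** The block i0 is solved for so that the consensus matrix of the result is
    [singular_block k z]; the other blocks are those of z. *)
Definition singular_param (k : 'I_3) (z : init_index n -> R) (x : init_index n) : R :=
  if x is (j, inl (a, b)) then
    if j == i0 then
      ((w 0 i0)^-1 *: invmx (A i0) *m
       (singular_block k z - \sum_(j | j != i0) w 0 j *: (A j *m init_Q z j))) a b
    else z x
  else z x.

Lemma loclip_singular_param k x :
  loclip (i0, inl (k, k)) (fun z => singular_param k z x).
Proof.
have lc y : y != (i0, inl (k, k)) -> loclip (i0, inl (k, k)) (fun z => z y).
  exact: loclip_coord.
case: x => [j [[a b]|a]] /=; last by apply: lc; rewrite xpair_eqE andbF.
have [_|ji0] := eqVneq j i0; last by apply: lc; rewrite xpair_eqE (negbTE ji0).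
clear j.
have E (f g : (init_index n -> R) -> R) : f =1 g ->
    loclip (i0, inl (k, k)) g -> loclip (i0, inl (k, k)) f.
  by move=> /funext->.
apply: (E _ _ (fun z => mxE _ _ _ _)); apply: loclip_sum => c _.
apply: loclipM; first exact: loclip_cst.
apply: (E _ (fun z => singular_block k z c b +
   (-1) * \sum_(j | j != i0) w 0 j * \sum_d A j c d * z (j, inl (d, b)))).
  move=> z; rewrite mxE; congr (_ + _); rewrite mxE summxE mulN1r; congr (- _).
  apply: eq_bigr => j _; rewrite 2!mxE; congr (_ * _); apply: eq_bigr => d _.
  by rewrite mxE.
apply: loclipD.
  apply: (E _ _ (fun z => mxE _ _ _ _)); have [bk|bk] := eqVneq b k.
    apply: loclip_sum => j jk; apply: loclipM; apply: lc;
      rewrite xpair_eqE eqxx /= -[_ == _]/((_, _) == (_, _)) xpair_eqE (negbTE jk) //.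
    by rewrite andbF.
  by apply: lc; rewrite xpair_eqE eqxx /= -[_ == _]/((_, _) == (_, _)) xpair_eqE
     (negbTE bk) andbF.
apply: loclipM; first exact: loclip_cst.
apply: loclip_sum => j ji0; apply: loclipM; first exact: loclip_cst.
apply: loclip_sum => d _; apply: loclipM; first exact: loclip_cst.
by apply: lc; rewrite xpair_eqE (negbTE ji0).
Qed.

(** The other blocks being given, the block i0 enters the consensus matrix through
    an invertible affine map, so it can be traded for a singular matrix, which
    has one parameter fewer than entries. *)
Lemma singular_consensus_thin : w 0 i0 != 0 -> A i0 \in unitmx ->
  thin [set x : init_index n -> R | \det (consensus_Q w A (init_Q x)) = 0].
Proof.
move=> w0 Au.
apply: (@thinS _ _ _ (\bigcup_(m : nat) range (singular_param (inord m)))).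
  move=> x /= /singular_column[k [c cP]].
  exists (nat_of_ord k) => //; rewrite inord_val.
  set M := consensus_Q w A (init_Q x) in cP.
  exists (fun y => if y is (j, inl (a, b)) then
     if j == i0 then if b == k then c a else M a b else x y else x y) => //.
  apply/funext => -[j [[a b]|a]] //=; have [->{j}|//] := eqVneq j i0.
  rewrite (_ : singular_block _ _ = M); last first.
    apply/matrixP => a' b'; rewrite mxE !eqxx; have [->|_ //] := eqVneq b' k.
    by rewrite cP; apply: eq_bigr => j /negbTE->.
  rewrite (_ : \sum_(j | j != i0) _ =
      \sum_(j | j != i0) w 0 j *: (A j *m init_Q x j)); last first.
    apply: eq_bigr => j ji0; congr (_ *: (_ *m _)).
    by apply/matrixP => a' b'; rewrite !mxE (negbTE ji0).
  rewrite /M /consensus_Q (bigD1 i0) //= addrK -scalemxAl -scalemxAr scalerA mulVf //.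
  by rewrite scale1r mulKmx // mxE.
apply: thin_bigcup => m; apply: (@thin_image _ _ (i0, inl (inord m, inord m))) => y.
exact: loclip_singular_param.
Qed.

End SingularConsensus.

(** * From poses to consensus *)

Section Transfer.
Variable R : realType.

Lemma is_derive_mx_entry m n (x : R -> 'M[R]_(m, n)) (t : R) (F : 'M[R]_(m, n)) i j :
  is_derive t 1 x F -> is_derive t 1 (fun s => x s i j) (F i j).
Proof.
move=> [dx <-]; have /derivable_mxP/(_ i j) dxij := dx.
by apply: DeriveDef => //; rewrite derive_mx // mxE.
Qed.

Lemma within_continuous_entry m n (D : set R) (x : R -> 'M[R]_(m, n)) i j :
  {within D, continuous x} -> {within D, continuous (fun s => x s i j)}.
Proof.
move=> cx s.
have ce : {for x s, continuous (fun M : 'M[R]_(m, n) => M i j)}.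
  exact: coord_continuous.
exact: (@continuous_comp (subspace D) _ _ x _ s (cx s) ce).
Qed.

Variables (n : nat) (e : rel 'I_n) (v omega : 'I_n -> R -> 'cV[R]_3).
Variables (T P : 'I_n -> R -> 'M[R]_(3 + 1)).

(** The contribution T_i twist_i P_i of T_i' cancels the velocity term of the law,
    and T_i T_i^-1 T_j P_j is the world-frame matrix of agent j. *)
Lemma world_frame_consensus :
  (forall i t, 0 <= t -> T i t \in unitmx) ->
  (forall i, solves (T i) (fun t => T i t *m twist (v i t) (omega i t))) ->
  (forall i, solves (P i) (localization_rhs e v omega T P i)) ->
  forall a b, consensus_sol e (fun i t => (T i t *m P i t) a b).
Proof.
move=> Tu sT sP a b; split=> [i|i t t0].
  have -> : (fun t => (T i t *m P i t) a b) = fun t => \sum_c T i t a c * P i t c b.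
    by apply/funext => t; rewrite mxE.
  move=> t; apply: cvg_big => [|c _]; first exact: add_continuous.
  by apply: cvgM; apply: within_continuous_entry; [exact: (sT i).1|exact: (sP i).1].
have -> : (fun t => (T i t *m P i t) a b) = fun t => \sum_c T i t a c * P i t c b.
  by apply/funext => s; rewrite mxE.
have [[_ /(_ t t0) dT] [_ /(_ t t0) dP]] := (sT i, sP i).
have H : is_derive t 1 (fun t => \sum_c T i t a c * P i t c b)
   (\sum_c (T i t a c *: localization_rhs e v omega T P i t c b +
            P i t c b *: (T i t *m twist (v i t) (omega i t)) a c)).
  apply: is_derive_bigsum => c _.
  exact: is_deriveM (is_derive_mx_entry a c dT) (is_derive_mx_entry c b dP).
apply: is_derive_eq H _.
have -> : \sum_(j | e i j) ((T j t *m P j t) a b - (T i t *m P i t) a b) =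
    (T i t *m localization_rhs e v omega T P i t +
     T i t *m twist (v i t) (omega i t) *m P i t) a b.
  rewrite /localization_rhs mulmxDr mulmxN mulmxA addrAC addNr add0r mulmx_sumr.
  rewrite summxE; apply: eq_bigr => j _.
  rewrite mulmxBr -!mulmxA (mulmxA (T i t)) mulmxV ?mul1mx ?Tu ?ltW //.
  by rewrite !mxE.
rewrite mxE [X in _ = X + _]mxE [X in _ = _ + X]mxE -big_split /=.
by apply: eq_bigr => c _; rewrite [_ * P i t c b]mulrC.
Qed.

End Transfer.

(** * Frame localization *)

Section Estimates.
Variable R : realType.
Variables (Rot Q : R -> 'M[R]_3) (p q : R -> 'cV[R]_3).
Variables (Qc : 'M[R]_3) (qc : 'cV[R]_3).
Hypothesis RotSO : forall t, 0 <= t -> SO3 (Rot t).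
Hypothesis Qc_unit : Qc \in unitmx.
Hypothesis cvgQ : exp_cvg (fun t => Rot t *m Q t) (fun=> Qc).
Hypothesis cvgq : exp_cvg (fun t => Rot t *m q t + p t) (fun=> qc).

Lemma exp_cvg_GSOP_world : exp_cvg (fun t => GSOP (Rot t *m Q t)) (fun=> GSOP Qc).
Proof.
have [L GL] := GSOP_lipschitz_at Qc_unit.
exact: (exp_cvg_dominated (L := L)) cvgQ.
Qed.

Lemma Rhat_world t : 0 <= t -> Rhat (Q t) = (GSOP (Rot t *m Q t))^T *m Rot t.
Proof.
move=> t0; have RS := RotSO t0; rewrite GSOP_rot // trmx_mul -mulmxA.
by case: RS => -> _; rewrite mulmx1.
Qed.

(** The position enters only through R q + p, which stays bounded whatever the
    growth of p. *)
Lemma That_pose_inv t : 0 <= t ->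
  That (Q t) (q t) *m invmx (pose (Rot t) (p t)) =
  pose (GSOP (Rot t *m Q t))^T
       (- ((GSOP (Rot t *m Q t))^T *m (Rot t *m q t + p t))).
Proof.
move=> t0; have RS := RotSO t0; have [_ ->] := pose_unit_inv (p t) RS.
rewrite /That /phat Rhat_world // pose_mul -mulmxA SO3_mulmx_tr // mulmx1.
congr pose; rewrite mulmxN !mulmxA -[_ *m Rot t *m _^T]mulmxA SO3_mulmx_tr // mulmx1.
by rewrite mulmxDr opprD addrC mulmxA.
Qed.

Lemma exp_cvg_Rhat :
  exp_cvg (fun t => Rhat (Q t)) (fun t => (GSOP Qc)^T *m Rot t).
Proof.
apply: exp_cvg_eq Rhat_world (fun _ _ => erefl) _.
apply: exp_cvg_mulr; first exact: exp_cvg_tr exp_cvg_GSOP_world.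
by apply: (subexponential_bounded (c := 1)) => t /RotSO /SO3_norm_le1.
Qed.

Lemma exp_cvg_That_inv :
  exp_cvg (fun t => That (Q t) (q t) *m invmx (pose (Rot t) (p t)))
          (fun=> invmx (pose (GSOP Qc) qc)).
Proof.
have [_ ->] := pose_unit_inv qc (GSOP_SO3 Qc_unit).
apply: exp_cvg_eq That_pose_inv (fun _ _ => erefl) _.
have cG := exp_cvg_tr exp_cvg_GSOP_world.
by apply: exp_cvg_pose (cG) _; apply: exp_cvgN; exact: exp_cvg_mul_cst cG cvgq.
Qed.

Lemma exp_cvg_That : subexponential p ->
  exp_cvg (fun t => That (Q t) (q t))
          (fun t => invmx (pose (GSOP Qc) qc) *m pose (Rot t) (p t)).
Proof.
move=> ps; have TK t : 0 <= t -> That (Q t) (q t) =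
    That (Q t) (q t) *m invmx (pose (Rot t) (p t)) *m pose (Rot t) (p t).
  by move=> /RotSO/(pose_unit_inv (p t))[U _]; rewrite mulmxKV.
apply: exp_cvg_eq TK (fun _ _ => erefl) _.
apply: exp_cvg_mulr exp_cvg_That_inv _; apply: pose_subexponential => //.
by apply: (subexponential_bounded (c := 1)) => t /RotSO /SO3_norm_le1.
Qed.

Lemma exp_cvg_phat : subexponential p ->
  exp_cvg (fun t => phat (Q t) (q t)) (fun t => (GSOP Qc)^T *m (p t - qc)).
Proof.
move=> /exp_cvg_That/exp_cvg_ursub; apply: exp_cvg_eq => t _.
  by rewrite block_mxKur.
have [_ ->] := pose_unit_inv qc (GSOP_SO3 Qc_unit).
by rewrite pose_mul block_mxKur mulmxBr.
Qed.

End Estimates.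

Lemma sum_scale_pose (R : realType) (I : finType) (c : I -> R)
    (A : I -> 'M[R]_3) (b : I -> 'cV[R]_3) : \sum_i c i = 1 ->
  \sum_i c i *: pose (A i) (b i) = pose (\sum_i c i *: A i) (\sum_i c i *: b i).
Proof.
move=> c1; have -> (s : seq I) : \sum_(i <- s) c i *: pose (A i) (b i) =
    block_mx (\sum_(i <- s) c i *: A i) (\sum_(i <- s) c i *: b i) 0
             (\sum_(i <- s) c i)%:M.
  elim: s => [|i s IH].
    by rewrite !big_nil (_ : 0%:M = 0) ?block_mx0 //; exact: raddf0.
  rewrite !big_cons IH scale_block_mx add_block_mx scaler0 addr0 scalemx1.
  by rewrite (raddfD (@scalar_mx R 1)).
by rewrite c1.
Qed.

Section KroneckerRow.
Variables (R : realType) (n : nat) (w : 'rV[R]_n).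
Hypothesis w1 : w *m const_mx 1 = 1%:M :> 'M[R]_1.

Lemma sum_weights : \sum_i w 0 i = 1.
Proof.
have := congr1 (fun M : 'M[R]_1 => M 0 0) w1; rewrite !mxE eqxx mulr1n => <-.
by apply: eq_bigr => i _; rewrite mxE mulr1.
Qed.

Lemma weight_neq0 : exists i, w 0 i != 0.
Proof.
apply/existsP; apply: contraT => /existsPn w0; have := sum_weights.
rewrite big1 => [/esym/eqP|i _]; first by rewrite oner_eq0.
by apply/eqP; have := w0 i; rewrite negbK.
Qed.

Lemma rank_coker_kron :
  \rank (cokermx (w *t (1%:M : 'M[R]_3))) = (3 * (n - 1))%N.
Proof.
have free : row_free (w *t (1%:M : 'M[R]_3)).
  apply/row_freeP; exists (const_mx 1 *t (1%:M : 'M[R]_3)).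
  rewrite tensmx_mul w1 mulmx1; apply/matrixP => i j.
  case: (mxtens_indexP i) => i1 i2; case: (mxtens_indexP j) => j1 j2.
  by rewrite tensmxE !mxE (can_eq (@mxtens_indexK _ _)) xpair_eqE -natrM mulnb.
by rewrite mxrank_coker (eqP free) -mulnBl mulnC.
Qed.

Lemma null_kron :
  lebesgue_null [set x : 'I_(n * 3) -> R | (w *t (1%:M : 'M[R]_3)) *m \col_k x k = 0].
Proof.
have [i wi] := weight_neq0; apply: thin_null.
pose r : 'I_(1 * 3) := mxtens_index (0, 0).
pose c k := (w *t (1%:M : 'M[R]_3)) r k.
have ci : c (mxtens_index (i, 0)) != 0 by rewrite /c tensmxE mxE eqxx mulr1.
apply: thinS (hyperplane_thin ci) => x /= /(congr1 (fun M : 'cV_(1 * 3) => M r 0)).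
rewrite [RHS]mxE; apply: etrans; rewrite [RHS]mxE.
by apply: eq_bigr => k _; rewrite [X in _ = _ * X]mxE.
Qed.

End KroneckerRow.

Theorem corollary2 (R : realType) (n : nat) (e : rel 'I_n)
    (v omega : 'I_n -> R -> 'cV[R]_3)
    (Rot : 'I_n -> R -> 'M[R]_3) (p : 'I_n -> R -> 'cV[R]_3)
    (w : 'rV[R]_n) :
  let T := fun i t => pose (Rot i t) (p i t) in
  has_spanning_tree e ->
  (forall i t, 0 <= t -> SO3 (Rot i t)) ->
  (forall i, solves (T i) (fun t => T i t *m twist (v i t) (omega i t))) ->
  w *m laplacian e R = 0 ->
  w *m const_mx 1 = 1%:M :> 'M[R]_1 ->
  let K := w *t (1%:M : 'M[R]_3) in
  let Qc := fun x : init_index n -> R =>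
    consensus_Q w (Rot ^~ 0) (init_Q x) in
  let qc := fun x : init_index n -> R =>
    consensus_q w (Rot ^~ 0) (p ^~ 0) (init_q x) in
  [/\ \rank (cokermx K) = (3 * (n - 1))%N,
      lebesgue_null [set x : 'I_(n * 3) -> R | K *m \col_k x k = 0],
      almost_all (fun x => Qc x \in unitmx)
    & almost_all (fun x : init_index n -> R =>
        let Rc := GSOP (Qc x) in
        let Tc := pose Rc (qc x) in
        SO3 Rc /\
        forall (Q : 'I_n -> R -> 'M[R]_3) (q : 'I_n -> R -> 'cV[R]_3),
          let P := fun i t => pose (Q i t) (q i t) in
          (forall i, Q i 0 = init_Q x i) ->
          (forall i, q i 0 = init_q x i) ->
          (forall i, solves (P i) (localization_rhs e v omega T P i)) ->
          forall i,
          [/\ exp_cvg (fun t => Rhat (Q i t)) (fun t => Rc^T *m Rot i t),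
              exp_cvg (fun t => That (Q i t) (q i t) *m invmx (T i t))
                      (fun=> invmx Tc)
            & subexponential (p i) ->
              exp_cvg (fun t => That (Q i t) (q i t))
                      (fun t => invmx Tc *m T i t) /\
              exp_cvg (fun t => phat (Q i t) (q i t))
                      (fun t => Rc^T *m (p i t - qc x))])].
Proof.
move=> T tree RotSO sT wL w1 K Qc qc.
have [i0 wi0] := weight_neq0 w1.
have Rot_unit : Rot i0 0 \in unitmx.
  by have [_ d1] := RotSO i0 0 (lexx 0); rewrite unitmxE d1 unitr1.
have thinQ : thin [set x | \det (Qc x) = 0].
  exact: singular_consensus_thin wi0 Rot_unit.
have QcP x : ~ (Qc x \in unitmx) -> \det (Qc x) = 0.
  by rewrite unitmxE unitfE => /negP; rewrite negbK => /eqP.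
split; [exact: rank_coker_kron|exact: null_kron| |].
  by apply: thin_null; apply: thinS thinQ => x /= /QcP.
apply: thin_null; apply: thinS thinQ => x /=; apply: contra_notP => detQ.
have Qcu : Qc x \in unitmx by apply/negPn/negP => /negP/QcP.
split=> [|Q q Q0 q0 sP i]; first exact: GSOP_SO3.
pose P j t := pose (Q j t) (q j t).
have Tu j t : 0 <= t -> T j t \in unitmx.
  by move=> t0; have [] := pose_unit_inv (p j t) (RotSO j t t0).
have sol := world_frame_consensus Tu sT sP.
have X0 : \sum_j w 0 j *: (T j 0 *m P j 0) = pose (Qc x) (qc x).
  under eq_bigr => j _ do rewrite pose_mul Q0 q0.
  exact: sum_scale_pose (sum_weights w1).
have X : exp_cvg (fun t => pose (Rot i t *m Q i t) (Rot i t *m q i t + p i t))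
                 (fun=> pose (Qc x) (qc x)).
  apply: (exp_cvg_entries (consensus_rate_gt0 R n)) => a b.
  have [c cP] := consensus_exponential tree wL (sum_weights w1) (sol a b).
  exists c => t t0; rewrite -pose_mul -X0 summxE.
  under [X in `|_ - X|]eq_bigr => j _ do rewrite mxE.
  exact: cP.
have XQ := exp_cvg_ulsub X; have Xq := exp_cvg_ursub X.
have cQ : exp_cvg (fun t => Rot i t *m Q i t) (fun=> Qc x).
  by apply: exp_cvg_eq XQ => t _; rewrite block_mxKul.
have cq : exp_cvg (fun t => Rot i t *m q i t + p i t) (fun=> qc x).
  by apply: exp_cvg_eq Xq => t _; rewrite block_mxKur.
split=> [||ps].
- exact: exp_cvg_Rhat (RotSO i) Qcu cQ.
- exact: exp_cvg_That_inv (RotSO i) Qcu cQ cq.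
- by split; [exact: exp_cvg_That (RotSO i) Qcu cQ cq ps
            |exact: exp_cvg_phat (RotSO i) Qcu cQ cq ps].
Qed.
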